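(* Consider $N$ nonholonomic agents $$\dot x_i=v_i\cos\theta_i,\qquad \dot y_i=v_i\sin\theta_i,\qquad \dot\theta_i=\omega_i,\qquad i=1,\dots,N,$$ with positions $q_i=(x_i,y_i)^{\mathsf T}\in\mathbb{R}^2$, orientations $\theta_i\in(-\pi,\pi]$, and saturated controls $$v_i=\mathrm{sat}_{vi}(\hat v_i),\quad \omega_i=\mathrm{sat}_{\omega i}(\hat\omega_i),\quad \hat v_i=\|\hat u_i\|\cos\tilde\theta_i,\quad \hat\omega_i=-k\tilde\theta_i,$$ where $k>0$ is any constant, $\hat u_i=(\hat u_{ix},\hat u_{iy})^{\mathsf T}=-\sum_{j\in\mathcal{N}_i(0)}\nabla_i\psi(\|q_{ij}\|)$, $\hat\theta_i=\mathrm{atan2}(\hat u_{iy},\hat u_{ix})$, $\tilde\theta_i=\theta_i-\hat\theta_i$, and $\psi,\Psi,\Psi_{max}$ are a generalized potential as in the context. Suppose that the initial communication graph is undirected and connected, that $\|q_{ij}(0)\|\le r-\epsilon$ for all $(i,j)\in\mathcal{E}(0)$ for some $\epsilon>0$, and that $\Psi(q(0))<\Psi_{max}$. Then the saturated control preserves the initial connectivity, i.e. $\|q_{ij}(t)\|<r$ for all $t\ge0$ and all $(i,j)\in\mathcal{E}(0)$, and achieves position coordination, i.e. $q_i(t)-q_j(t)\to0$ as $t\to\infty$ for all $i,j\in\{1,\dots,N\}$.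
   Context: All agents have communication radius $r>0$; $\mathcal{E}(0)$ is the initial edge set and $\mathcal{N}_i(0)=\{j:(i,j)\in\mathcal{E}(0)\}$ is the set of initial neighbours of agent $i$. Put $q_{ij}=q_j-q_i$ and $q=(q_1^{\mathsf T},\dots,q_N^{\mathsf T})^{\mathsf T}$; $\nabla_i$ is the gradient with respect to $q_i$. Each of $\mathrm{sat}_{vi},\mathrm{sat}_{\omega i}$ is a standard saturation function with some bounds $\underline b<0<\overline b$: it equals the identity on $[\underline b,\overline b]$, $\overline b$ above and $\underline b$ below. Generalized potential: $\Psi(q)=\frac12\sum_{i=1}^N\sum_{j\in\mathcal{N}_i(0)}\psi(\|q_{ij}\|)$, where 1. $\psi(\|q_{ij}\|)\ge0$, and $\|q_{ij}\|=0\Leftrightarrow\psi(\|q_{ij}\|)=0$; 2. $\frac{\partial\psi(\|q_{ij}\|)}{\partial\|q_{ij}\|^2}$ exists and is positive at every point $\|q_{ij}\|\in[0,r)$ (so $\nabla_i\psi(\|q_{ij}\|)=2\frac{\partial\psi(\|q_{ij}\|)}{\partial\|q_{ij}\|^2}(q_i-q_j)$); 3. $\Psi(q)=\Psi_{max}$ when there is $(i,j)\in\mathcal{E}(0)$ with $\|q_{ij}\|=r$, where $\Psi_{max}$, the maximum of $\Psi$, is not necessarily bounded (it may be $+\infty$).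
   Formalization: The potential is additionally assumed to have a continuous derivative with respect to the squared distance on [0,r), and ψ(s) is assumed to tend to ψ(r) (possibly +∞) as s→r from below; without either assumption the claim fails. *)

(* Defs.v *)
From HB Require Import structures.
From mathcomp Require Import all_boot all_order all_algebra.
From mathcomp Require Import all_classical all_reals all_analysis.

Set Implicit Arguments.
Unset Strict Implicit.
Unset Printing Implicit Defensive.

Import Order.TTheory GRing.Theory Num.Theory.
Import numFieldNormedType.Exports.

Local Open Scope classical_set_scope.
Local Open Scope ring_scope.

Section Defs.
Context {R : realType}.

(* The norm carried by the normed module 'rV[R]_2 is the sup norm, hence this
   separate Euclidean norm. *)
Definition enorm (p : 'rV[R]_2) : R := Num.sqrt (p 0 0 ^+ 2 + p 0 1 ^+ 2).

Definition grad (f : 'rV[R]_2 -> R) (p : 'rV[R]_2) : 'rV[R]_2 :=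
  \row_(l < 2) 'D_(delta_mx 0 l) f p.

(* Principal argument of (x, y), with values in (- pi, pi]; at the origin it is
   0 by convention. *)
Definition atan2 (y x : R) : R :=
  if 0 < x then atan (y / x)
  else if x < 0 then
    (if 0 <= y then atan (y / x) + pi else atan (y / x) - pi)
  else if 0 < y then pi / 2
  else if y < 0 then - (pi / 2)
  else 0.

Definition sat (lo hi x : R) : R :=
  if x < lo then lo else if hi < x then hi else x.

(* f is a solution on [0, +oo) of f' = g in the sense of Caratheodory.
   Classical differentiability would be too restrictive for the closed loop
   below: its right-hand side jumps when the argument of a control vector
   crosses the branch cut of atan2. *)
Definition caratheodory (f g : R -> R) : Prop :=
  forall t : R, 0 <= t ->
    (@lebesgue_measure R).-integrable `[0, t] (EFin \o g) /\
    f t = f 0 + \int[@lebesgue_measure R]_(s in `[0, t]) g s.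

(* d is the derivative of psi with respect to the square of its argument at
   the point s >= 0, that is, the derivative of u |-> psi (sqrt u) at s ^ 2;
   it is one-sided (from the right) when s = 0. *)
Definition is_deriv_sq (psi : R -> \bar R) (s d : R) : Prop :=
  (fine (psi (Num.sqrt u)) - fine (psi s)) / (u - s ^+ 2)
    @[u --> within [set u : R | 0 <= u] ((s ^+ 2)^')] --> d.

Section Network.
Variable N : nat.
Variable E : rel 'I_N.

Definition undirected_graph : Prop := irreflexive E /\ symmetric E.

Definition connected_graph : Prop := forall i j : 'I_N, connect E i j.

Section Potential.
Variable psi : R -> \bar R.

Definition total_potential (q : 'I_N -> 'rV[R]_2) : \bar R :=
  ((2^-1)%:E * \sum_(i < N) \sum_(j < N | E i j) psi (enorm (q j - q i)))%E.

(* psi is only meaningful on [0, r], where it may take the value +oo at r. *)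
Record generalized_potential (r : R) (Psi_max : \bar R) : Prop := {
  potential_ge0 : forall s : R, 0 <= s <= r -> (0 <= psi s)%E;
  potential_eq0 : forall s : R, 0 <= s <= r -> (s = 0 <-> psi s = 0%E);
  potential_fin : forall s : R, 0 <= s < r -> psi s \is a fin_num;
  potential_deriv : exists dpsi : R -> R,
    (forall s : R, 0 <= s < r -> is_deriv_sq psi s (dpsi s) /\ 0 < dpsi s) /\
    {within `[0, r[, continuous dpsi};
  potential_cont : psi s @[s --> r^'-] --> psi r;
  potential_boundary : forall q : 'I_N -> 'rV[R]_2,
    (forall i j, E i j -> enorm (q j - q i) <= r) ->
    (exists i j, E i j /\ enorm (q j - q i) = r) ->
    total_potential q = Psi_max;
  potential_max : forall q : 'I_N -> 'rV[R]_2,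
    (forall i j, E i j -> enorm (q j - q i) <= r) ->
    (total_potential q <= Psi_max)%E }.

Definition uhat (q : 'I_N -> 'rV[R]_2) (i : 'I_N) : 'rV[R]_2 :=
  - \sum_(j < N | E i j) grad (fun z => fine (psi (enorm (q j - z)))) (q i).

Definition thetahat (q : 'I_N -> 'rV[R]_2) (i : 'I_N) : R :=
  atan2 (uhat q i 0 1) (uhat q i 0 0).

Definition thetatilde (q : 'I_N -> 'rV[R]_2) (theta : 'I_N -> R) (i : 'I_N) : R :=
  theta i - thetahat q i.

Definition vhat (q : 'I_N -> 'rV[R]_2) (theta : 'I_N -> R) (i : 'I_N) : R :=
  enorm (uhat q i) * cos (thetatilde q theta i).

Definition omegahat (k : R) (q : 'I_N -> 'rV[R]_2) (theta : 'I_N -> R)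
    (i : 'I_N) : R :=
  - k * thetatilde q theta i.

(* The orientations need no reduction modulo 2 pi: omega i has the sign of
   thetahat i - theta i, which keeps theta i in (- pi, pi]. *)
Record closed_loop (k : R) (vlo vhi wlo whi : 'I_N -> R)
    (q : R -> 'I_N -> 'rV[R]_2) (theta : R -> 'I_N -> R) : Prop := {
  orientation_range : forall (t : R) (i : 'I_N), 0 <= t -> - pi < theta t i <= pi;
  dynamics_x : forall i, caratheodory (fun t => q t i 0 0)
    (fun t => sat (vlo i) (vhi i) (vhat (q t) (theta t) i) * cos (theta t i));
  dynamics_y : forall i, caratheodory (fun t => q t i 0 1)
    (fun t => sat (vlo i) (vhi i) (vhat (q t) (theta t) i) * sin (theta t i));
  dynamics_theta : forall i, caratheodory (fun t => theta t i)
    (fun t => sat (wlo i) (whi i) (omegahat k (q t) (theta t) i)) }.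

End Potential.
End Network.
End Defs.

(* Main.v *)
Require Import Defs.
From HB Require Import structures.
From mathcomp Require Import all_boot all_order all_algebra.
From mathcomp Require Import all_classical all_reals all_analysis.
From mathcomp Require Import ring lra.

Set Implicit Arguments.
Unset Strict Implicit.
Unset Printing Implicit Defensive.

Import Order.TTheory GRing.Theory Num.Theory.
Import numFieldNormedType.Exports.

Local Open Scope classical_set_scope.
Local Open Scope ring_scope.

(** Let [Psi] be the total potential. With [u_i] the negative gradient of [Psi]
    with respect to [q_i] and [vh_i = u_i . (cos theta_i, sin theta_i)] the
    unsaturated speed, the symmetry of the graph gives
    [dPsi/dt = - sum_i vh_i * sat vh_i <= 0] as long as all edges are shorter
    than [r] ([energy_derive]). As soon as there is an edge, the maximal
    potential equals [psi r] if the latter is finite ([Psi_max_eq]), so an initial value below the maximum keeps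
    every edge below some [rho < r] ([profile_barrier]), and a first-exit
    argument shows that no edge is ever lost ([always_linked]).

    Everything then stays in a compact set of configurations, the dissipation is
    uniformly continuous in time, and Barbalat's lemma yields [vh_i -> 0]
    ([speed_vanishing]). Hence the positions, and with them the vectors [u_i],
    vary arbitrarily little over time windows of any fixed length
    ([slow_motion], [small_osc_force]).

    The right-hand side of the orientation dynamics jumps where [u_i] crosses
    the half line [y = 0, x <= 0]. Only bounds on this right-hand side over
    intervals are therefore used ([has_rate]), and an invariance principle is
    replaced by a direct argument ([force_near_cut]): if [u_i] is away from that
    half line at a late time, it is so during a long window, on which the heading
    error is continuous and has a cosine close to 0; it then has constant sign
    and modulus at least [pi/4], and the agent makes more than a full turn,
    contradicting [theta_i] in [(-pi, pi]]. So the second component of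
    [u_i] tends to zero and the upper limit of the first one is at most zero.
    This does not exclude that a single agent stops while [u_i] chatters across
    the half line; but the [u_i] sum to zero, so they all tend to zero
    ([force_x_vanishing]). Finally
    [- sum_i u_i . q_i] dominates a positive multiple of the squared length of
    every edge, so that edges shrink to zero, and the graph is connected
    ([consensus]). *)

(** * Bounds on the increments of a Caratheodory solution *)

Section Rate.
Context {R : realType}.
Implicit Types f g : R -> R.

(** The increments of [f] over an interval of nonnegative times lie between
    the bounds that [g] satisfies there: a derivative in a weak sense, without
    integrals and without a regularity assumption on [g]. *)
Definition has_rate f g : Prop :=
  forall a b m, 0 <= a -> a <= b ->
    ((forall s, a <= s <= b -> m <= g s) -> m * (b - a) <= f b - f a) /\
    ((forall s, a <= s <= b -> g s <= m) -> f b - f a <= m * (b - a)).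

Lemma caratheodory_increment f g a b : caratheodory f g -> 0 <= a -> a <= b ->
  (@lebesgue_measure R).-integrable `[a, b] (EFin \o g) /\
  f b - f a = \int[@lebesgue_measure R]_(s in `[a, b]) g s.
Proof.
move=> fg a0 ab.
have b0 : 0 <= b by exact: le_trans ab.
have [_ fa] := fg a a0; have [ib fb] := fg b b0.
split.
  apply: integrableS ib => //.
  by apply: subset_itvr; rewrite bnd_simp.
rewrite fa fb opprD addrACA subrr add0r.
rewrite Rintegral_itvB //.
- rewrite Rintegral_itv_obnd_cbnd //.
  by apply: integrableS ib => //; apply: subset_itvr; rewrite bnd_simp.
Qed.

Lemma caratheodory_rate f g : caratheodory f g -> has_rate f g.
Proof.
move=> fg a b m a0 ab.
have [ig ->] := caratheodory_increment fg a0 ab.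
have cstE (c : R) : \int[@lebesgue_measure R]_(s in `[a, b]) c = c * (b - a).
  rewrite Rintegral_cst //= lebesgue_measure_itv /= lte_fin.
  move: ab; rewrite le_eqVlt => /predU1P[->|->//].
  by rewrite ltxx subrr.
have icst (c : R) : (@lebesgue_measure R).-integrable `[a, b] (EFin \o cst c).
  apply: continuous_compact_integrable; first exact: segment_compact.
  by move=> ?; exact: cvg_cst.

split=> gm.
- rewrite -cstE; apply: le_Rintegral => //; first exact: icst.
- rewrite -cstE; apply: le_Rintegral => //; first exact: icst.
Qed.

Lemma has_rate_lipschitz f g M : has_rate f g ->
  (forall s, 0 <= s -> `|g s| <= M) ->
  forall a b, 0 <= a -> 0 <= b -> `|f a - f b| <= M * `|a - b|.
Proof.
move=> fg gM.
have main a b : 0 <= a -> a <= b -> `|f a - f b| <= M * `|a - b|.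
  move=> a0 ab; rewrite distrC (distrC a) (ger0_norm (_ : 0 <= b - a)) ?subr_ge0 //.
  have gs s : a <= s <= b -> - M <= g s <= M.
    by case/andP=> as_ _; rewrite -ler_norml gM // (le_trans a0).
  have [lo _] := fg a b (- M) a0 ab; have [_ hi] := fg a b M a0 ab.
  rewrite ler_norml -mulNr lo ?hi //.
  - by move=> s /gs /andP[].
  - by move=> s /gs /andP[].
move=> a b a0 b0; case: (leP a b) => [|/ltW] ab; first exact: main.
by rewrite distrC (distrC a); exact: main.
Qed.

Lemma has_rate_derive f g t : has_rate f g -> 0 < t -> {for t, continuous g} ->
  is_derive t 1 f (g t).
Proof.
move=> fg t0 gt.
suff lim : h^-1 *: (f (h *: 1 + t) - f t) @[h --> 0^'] --> g t.
  by split; [apply/cvg_ex; exists (g t) | exact: cvg_lim lim].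
apply/cvgrPdist_le => /= e e0.
have /cvgrPdist_le /(_ _ e0) : g s @[s --> t] --> g t by exact: gt.
case=> d /= d0 gd.
near=> h.
have h0 : h != 0 by near: h; exact: nbhs_dnbhs_neq.
have hd : `|h| < Num.min d t.
  by near: h; apply: dnbhs0_lt; rewrite lt_min d0 t0.
move: hd; rewrite lt_min => /andP[hd ht].
have gs s : `|t - s| <= `|h| -> g t - e <= g s <= g t + e.
  move=> ts; have := gd s (le_lt_trans ts hd).
  by rewrite ler_norml => /andP[? ?]; apply/andP; split; lra.
rewrite /GRing.scale /= mulr1.
have key a b : 0 <= a -> a < b -> b - a = `|h| ->
    (forall s, a <= s <= b -> `|t - s| <= `|h|) ->
    `|g t - (b - a)^-1 * (f b - f a)| <= e.
  move=> a0 ab abh st.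
  have ba : 0 < b - a by rewrite subr_gt0.
  have [+ _] := fg a b (g t - e) a0 (ltW ab).
  have [_ +] := fg a b (g t + e) a0 (ltW ab).
  move=> /(_ (fun s hs => (andP (gs s (st s hs))).2)) hi.
  move=> /(_ (fun s hs => (andP (gs s (st s hs))).1)) lo.
  rewrite ler_distlC mulrC ler_pdivlMr // ler_pdivrMr //.
  by rewrite lo hi.
have [hpos|hneg] := ltP 0 h.
  have := key t (h + t); rewrite addrK; apply => //; first exact: ltW.
  - by rewrite ltrDr.
  - by rewrite gtr0_norm.
  - by move=> s /andP[s1 s2]; rewrite ler_norml (gtr0_norm hpos); apply/andP; split; lra.
have {}hneg : h < 0 by rewrite lt_neqAle h0.
have := key (h + t) t.
rewrite (_ : t - (h + t) = - h); last by ring.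
rewrite -(opprB (f (h + t))) invrN mulrNN; apply.
- by move: ht; rewrite ltr0_norm //; lra.
- by rewrite gtrDr.
- by rewrite ltr0_norm.
- by move=> s /andP[s1 s2]; rewrite ler_norml (ltr0_norm hneg); apply/andP; split; lra.
Unshelve. all: by end_near.
Qed.
End Rate.

(** * Uniform continuity, slow variation and Barbalat's lemma *)

Section BoundedUniform.
Context {R : realType}.
Implicit Types f g : R -> R.

Lemma Heine_segment (h : R -> R) (a b : R) : {in `[a, b], continuous h} ->
  forall e, 0 < e -> exists2 d, 0 < d & forall u v, u \in `[a, b] -> v \in `[a, b] ->
    `|u - v| < d -> `|h u - h v| < e.
Proof.
move=> hc e e0.
have /compact_near_coveringP := @segment_compact R a b.
pose P (d u : R) := u \in `[a, b] -> forall v, v \in `[a, b] -> `|u - v| < d -> `|h u - h v| < e.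
move=> /(_ R (0 : R)^'+ P _) [].
  move=> x abx.
  have /cvgrPdist_lt /(_ _ (divr_gt0 e0 (ltr0Sn _ 1))) : h y @[y --> x] --> h x.
    by apply: hc; rewrite inE.
  case=> d /= d0 hd.
  exists (ball x (d / 2), [set d' | d' < d / 2]).
    split; first by apply: nbhsx_ballx; rewrite divr_gt0.
    by apply: nbhs_right_lt; rewrite divr_gt0.
  case=> u d' [] /= xu d'd uab v vab uv.
  have h1 := hd u; have h2 := hd v.
  rewrite (splitr e) (le_lt_trans (ler_distD (h x) _ _)) // ltrD //.
    rewrite distrC; apply: h1; apply: lt_trans xu _; lra.
  apply: h2; apply: le_lt_trans (ler_distD u _ _) _.
  by move: xu; rewrite /ball /= => xu; lra.
move=> d0 /= d0_gt0 hd0.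
have d02 : 0 < d0 / 2 by rewrite divr_gt0.
exists (d0 / 2) => // u v uab vab uv.
apply: (hd0 (d0 / 2) _ _ u) => //=.
by rewrite sub0r normrN gtr0_norm //; lra.
Qed.

(** An abstract oscillation scale: [U d] relates the pairs of nonnegative times
    over which the variation is measured, and shrinks with [d]. Uniform
    continuity and slow variation over windows of a fixed length are two
    instances. *)
Definition oscillation_scale (U : R -> R -> R -> Prop) : Prop :=
  (forall d d' s t, d <= d' -> U d s t -> U d' s t) /\
  (forall d s t, U d s t -> 0 <= s /\ 0 <= t).

(** Functions bounded on the nonnegative times whose oscillation at scale [U d]
    tends to zero with [d]. *)
Definition small_osc (U : R -> R -> R -> Prop) f : Prop :=
  (exists M, forall t, 0 <= t -> `|f t| <= M) /\
  (forall e, 0 < e -> exists2 d, 0 < d & forall s t, U d s t -> `|f s - f t| < e).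

Section SmallOscillation.
Variable U : R -> R -> R -> Prop.
Hypothesis Uscale : oscillation_scale U.

Lemma small_osc_ext f g : (forall t, 0 <= t -> f t = g t) ->
  small_osc U f -> small_osc U g.
Proof.
move=> fg [[M fM] fu]; split.
  by exists M => t t0; rewrite -fg // fM.
move=> e /fu[d d0 fd]; exists d => // s t st.
by have [s0 t0] := Uscale.2 _ _ _ st; rewrite -!fg // fd.
Qed.

Lemma small_oscD f g : small_osc U f -> small_osc U g ->
  small_osc U (fun t => f t + g t).
Proof.
move=> [[M fM] fu] [[M' gM] gu]; split.
  by exists (M + M') => t t0; rewrite (le_trans (ler_normD _ _)) // lerD ?fM ?gM.
move=> e e0; have e2 : 0 < e / 2 by rewrite divr_gt0.
have [d d0 fd] := fu _ e2; have [d' d'0 gd] := gu _ e2.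
exists (Num.min d d'); first by rewrite lt_min d0.
move=> s t st.
have sd : U d s t by apply: Uscale.1 st; rewrite ge_min lexx.
have sd' : U d' s t by apply: Uscale.1 st; rewrite ge_min lexx orbT.
rewrite opprD addrACA (splitr e) (le_lt_trans (ler_normD _ _)) //.
by rewrite ltrD ?fd ?gd.
Qed.

Lemma small_oscM f g : small_osc U f -> small_osc U g ->
  small_osc U (fun t => f t * g t).
Proof.
move=> [[M fM] fu] [[M' gM] gu].
have M0 : 0 <= M by exact: le_trans (fM 0 (lexx _)).
have M'0 : 0 <= M' by exact: le_trans (gM 0 (lexx _)).
split.
  by exists (M * M') => t t0; rewrite normrM ler_pM ?fM ?gM.
move=> e e0.
have K0 : 0 < M + M' + 1 by lra.
have e2 : 0 < e / (M + M' + 1) by rewrite divr_gt0.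
have [d d0 fd] := fu _ e2; have [d' d'0 gd] := gu _ e2.
exists (Num.min d d'); first by rewrite lt_min d0.
move=> s t st.
have sd : U d s t by apply: Uscale.1 st; rewrite ge_min lexx.
have sd' : U d' s t by apply: Uscale.1 st; rewrite ge_min lexx orbT.
have [s0 t0] := Uscale.2 _ _ _ st.
rewrite (_ : _ - _ = f s * (g s - g t) + (f s - f t) * g t); last by ring.
apply: (@le_lt_trans _ _ ((M + M') * (e / (M + M' + 1)))).
  rewrite (le_trans (ler_normD _ _)) // !normrM mulrDl lerD //.
    by rewrite ler_pM ?fM // ltW // gd.
  by rewrite mulrC ler_pM ?gM // ltW // fd.
by rewrite mulrCA gtr_pMr // ltr_pdivrMr //; lra.
Qed.

Lemma small_osc_cst (c : R) : small_osc U (fun=> c).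
Proof.
split; first by exists `|c|.
by move=> e e0; exists 1 => // s t _; rewrite subrr normr0.
Qed.

Lemma small_osc_sum (I : finType) (P : pred I) (f : I -> R -> R) :
  (forall i, P i -> small_osc U (f i)) -> small_osc U (fun t => \sum_(i | P i) f i t).
Proof.
move=> fb; rewrite (_ : (fun t => _) = \sum_(i | P i) f i); last first.
  by apply/funext => t; rewrite fct_sumE.
elim/big_ind: _ => //; first exact: (small_osc_cst 0).
by move=> ? ? h1 h2; exact: (small_oscD h1 h2).
Qed.

Lemma small_osc_comp (h : R -> R) (a b : R) f : {in `[a, b], continuous h} ->
  (forall t, 0 <= t -> f t \in `[a, b]) -> small_osc U f -> small_osc U (h \o f).
Proof.
move=> hc fab [_ fu].
have ab : a <= b.
  by have := fab 0 (lexx _); rewrite in_itv /= => /andP[]; exact: le_trans.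
have wc : {within `[a, b], continuous h}.
  by apply: continuous_in_subspaceT => u; rewrite inE => /hc.
have [c1 c1ab Hmax] := EVT_max ab wc.
have [c2 c2ab Hmin] := EVT_min ab wc.
split.
  exists (`|h c1| + `|h c2|) => t t0 /=.
  have := Hmax _ (fab _ t0); have := Hmin _ (fab _ t0).
  have := ler_norm (h c1); have := ler_norm (- h c2); rewrite normrN.
  have := normr_ge0 (h c1); have := normr_ge0 (h c2).
  by move=> *; rewrite ler_norml; apply/andP; split; lra.
move=> e /(Heine_segment hc)[d d0 hd].
have [d' d'0 fd] := fu _ d0.
exists d' => // s t st; have [s0 t0] := Uscale.2 _ _ _ st.
by apply: hd; rewrite ?fab // fd.
Qed.

Lemma small_osc_continuous (h : R -> R) f : continuous h ->
  small_osc U f -> small_osc U (h \o f).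
Proof.
move=> hc sf; have [[M fM] _] := sf.
apply: (@small_osc_comp h (- M) M) => // t t0.
by rewrite in_itv /= -ler_norml fM.
Qed.

End SmallOscillation.

(** Pairs of nonnegative times at distance less than [d]: the scale of uniform
    continuity. *)
Definition close_times (d s t : R) : Prop := [/\ 0 <= s, 0 <= t & `|s - t| < d].

Lemma close_times_scale : oscillation_scale close_times.
Proof.
split=> [d d' s t dd' [s0 t0 st]|d s t [] //].
by split=> //; exact: lt_le_trans dd'.
Qed.

Lemma small_osc_lipschitz f M L : (forall t, 0 <= t -> `|f t| <= M) ->
  (forall s t, `|f s - f t| <= L * `|s - t|) -> small_osc close_times f.
Proof.
move=> fM fL; split; first by exists M.
move=> e e0; have L1 : 0 < `|L| + 1 by rewrite ltr_wpDl.
exists (e / (`|L| + 1)); first by rewrite divr_gt0.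
move=> s t [s0 t0]; rewrite ltr_pdivlMr // => st.
apply: le_lt_trans (fL s t) _; apply: le_lt_trans st.
rewrite mulrC ler_wpM2l // (le_trans (ler_norm _)) //; lra.
Qed.

(** Pairs of a time after [d^-1] and a time at most [tau] later: the scale of
    slow variation over windows of length [tau]. *)
Definition late_window (tau d s t : R) : Prop :=
  [/\ 0 < d, d^-1 <= s, s <= t & t <= s + tau].

Lemma late_window_scale tau : oscillation_scale (late_window tau).
Proof.
split=> [d d' s t dd' [d0 ds st ts]|d s t [d0 ds st _]].
  split=> //; first exact: lt_le_trans dd'.
  by apply: le_trans ds; rewrite lef_pV2 ?posrE // (lt_le_trans d0).
have s0 : 0 <= s by apply: le_trans ds; rewrite invr_ge0 ltW.
by split=> //; exact: le_trans st.
Qed.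

(** [f] tends to zero at infinity. *)
Definition vanishing f : Prop :=
  forall e, 0 < e -> exists2 T, 0 <= T & forall t, T <= t -> `|f t| < e.

Lemma vanishingD f g : vanishing f -> vanishing g -> vanishing (fun t => f t + g t).
Proof.
move=> f0 g0 e e0; have e2 : 0 < e / 2 by rewrite divr_gt0.
have [T T0 fT] := f0 _ e2; have [T' T'0 gT] := g0 _ e2.
exists (Num.max T T') => [|t]; first by rewrite le_max T0.
rewrite ge_max => /andP[Tt T't].
by rewrite (splitr e) (le_lt_trans (ler_normD _ _)) // ltrD ?fT ?gT.
Qed.

Lemma vanishing_bounded f g C : (forall t, 0 <= t -> `|g t| <= C) ->
  vanishing f -> vanishing (fun t => f t * g t).
Proof.
move=> gC f0 e e0.
have C0 : 0 <= C by exact: le_trans (gC 0 (lexx _)).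
have C1 : 0 < C + 1 by lra.
have [T T0 fT] := f0 _ (divr_gt0 e0 C1).
exists T => // t Tt; have t0 : 0 <= t by exact: le_trans Tt.
have := fT t Tt; rewrite ltr_pdivlMr // normrM; apply: le_lt_trans.
by rewrite ler_wpM2l // (le_trans (gC t t0)) //; lra.
Qed.

Lemma vanishing_sum (I : finType) (P : pred I) (f : I -> R -> R) :
  (forall i, P i -> vanishing (f i)) -> vanishing (fun t => \sum_(i | P i) f i t).
Proof.
move=> f0; rewrite (_ : (fun t => _) = \sum_(i | P i) f i); last first.
  by apply/funext => t; rewrite fct_sumE.
elim/big_ind: _ => //; first by move=> e e0; exists 0 => // t _; rewrite normr0.
by move=> ? ? h1 h2; exact: (vanishingD h1 h2).
Qed.


Lemma vanishing_sqr_le f g (c : R) : 0 < c ->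
  (forall t, 0 <= t -> c * f t ^+ 2 <= `|g t|) -> vanishing g -> vanishing f.
Proof.
move=> c0 fg g0 e e0.
have ce : 0 < c * e ^+ 2 by rewrite mulr_gt0 // exprn_gt0.
have [T T0 gT] := g0 _ ce; exists T => // t Tt.
have := le_lt_trans (fg t (le_trans T0 Tt)) (gT t Tt).
by rewrite ltr_pM2l // -real_normK ?num_real // ltr_pXn2r // ?nnegrE // ltW.
Qed.

Lemma vanishing_cvg f : vanishing f -> f t @[t --> +oo] --> 0.
Proof.
move=> f0; apply/cvgrPdist_lt => e e0; have [T T0 fT] := f0 e e0.
near=> t; rewrite sub0r normrN fT //; near: t; exact: nbhs_pinfty_ge.
Unshelve. all: by end_near.
Qed.

(** Barbalat's lemma for a Lyapunov function: a nonnegative uniformly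
    continuous dissipation rate tends to zero. *)
Lemma Barbalat (V W : R -> R) : small_osc close_times W -> (forall t, 0 <= t -> 0 <= W t) ->
  (forall t, 0 <= t -> 0 <= V t) ->
  (forall t : R, 0 <= t -> {for t, continuous V}) ->
  (forall t : R, 0 < t -> is_derive t 1 V (- W t)) ->
  vanishing W.
Proof.
move=> [_ Wu] W0 V0 Vc Vd e e0.
have e2 : 0 < e / 2 by rewrite divr_gt0.
have [d d0 Wd] := Wu _ e2.
have mvt a b : 0 <= a -> a < b ->
    exists2 c, c \in `]a, b[ & V b - V a = - W c * (b - a).
  move=> a0 ab; apply: (@MVT _ V (fun c => - W c)) => //.
    by move=> c; rewrite in_itv /= => /andP[ac _]; exact: Vd (le_lt_trans a0 ac).
  apply: continuous_in_subspaceT => u; rewrite inE /= in_itv /= => /andP[au _].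
  exact: Vc (le_trans a0 au).
have Vnincr a b : 0 <= a -> a <= b -> V b <= V a.
  move=> a0; rewrite le_eqVlt => /predU1P[->//|ab].
  have [c] := mvt a b a0 ab; rewrite in_itv /= => /andP[ac _] Vba.
  rewrite -subr_le0 Vba mulNr oppr_le0 mulr_ge0 //; last by rewrite subr_ge0 ltW.
  exact: W0 (le_trans a0 (ltW ac)).
pose S := V @` [set t | 0 <= t].
have Si : has_inf S.
  split; first by exists (V 0); exists 0 => /=.
  by exists 0 => _ [t t0 <-]; exact: V0.
have d2 : 0 < d / 2 by rewrite divr_gt0.
have ed : 0 < e / 2 * (d / 2) by rewrite mulr_gt0.
have [_ [T T0 <-] VT] := inf_adherent ed Si.
exists T => // t Tt.
have t0 : 0 <= t by exact: le_trans Tt.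
rewrite ger0_norm ?W0 // ltNge; apply/negP => Wt.
have [|c] := mvt t (t + d / 2) t0; first by rewrite ltrDl.
rewrite in_itv /= => /andP[tc ct] Vtc.
have Wc : e / 2 <= W c.
  have : `|t - c| < d by rewrite ltr_norml; apply/andP; split; lra.
  move=> tcd; have := Wd t c (And3 t0 (le_trans t0 (ltW tc)) tcd).
  by rewrite ltr_norml => /andP[_ ?]; lra.
have h1 : V t <= V T by exact: Vnincr.
have h2 : inf S <= V (t + d / 2).
  apply: ge_inf; first exact: Si.2.
  by exists (t + d / 2) => //=; rewrite addr_ge0 // ltW.
have h3 : e / 2 * (d / 2) <= W c * (d / 2) by rewrite ler_wpM2r // ltW.
move: Vtc; rewrite (_ : t + d / 2 - t = d / 2) ?mulNr; last by ring.
by lra.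
Qed.

End BoundedUniform.

(** * The principal argument off its branch cut *)

Section Atan2.
Context {R : realType}.
Implicit Types x y : R.

(* The Euclidean norm of (x, y). *)
Let hyp x y : R := Num.sqrt (x ^+ 2 + y ^+ 2).

Lemma hypot_cos_atan x y : x != 0 -> hyp x y * cos (atan (y / x)) = `|x|.
Proof.
move=> x0.
have -> : hyp x y = `|x| * Num.sqrt (1 + (y / x) ^+ 2).
  rewrite -sqrtr_sqr -sqrtrM ?sqr_ge0 //; congr Num.sqrt.
  by field.
rewrite cos_atan -mulrA mulfV ?mulr1 //.
by rewrite gt_eqF // sqrtr_gt0 ltr_pwDl // sqr_ge0.
Qed.

Lemma hypot_sin_atan x y : x != 0 -> hyp x y * sin (atan (y / x)) = `|x| * (y / x).
Proof.
move=> x0; rewrite -(hypot_cos_atan y x0) -mulrA; congr (_ * _).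
have c0 : cos (atan (y / x)) != 0.
  by rewrite gt_eqF // cos_gt0_pihalf // atan_gtNpi2 atan_ltpi2.
by rewrite -{3}(atanK (y / x)) /tan mulrCA mulfV // mulr1.
Qed.

Lemma atan2_polar x y :
  hyp x y * cos (atan2 y x) = x /\ hyp x y * sin (atan2 y x) = y.
Proof.
rewrite /atan2; case: (ltgtP 0 x) => x0.
- have x_neq0 : x != 0 by rewrite gt_eqF.
  rewrite hypot_cos_atan // hypot_sin_atan // gtr0_norm //.
  by split=> //; field.
- have x_neq0 : x != 0 by rewrite lt_eqF.
  have E (s : R) : s = 1 \/ s = -1 ->
      hyp x y * - cos (atan (y / x)) = x /\ hyp x y * - sin (atan (y / x)) = y.
    by rewrite !mulrN hypot_cos_atan // hypot_sin_atan // ltr0_norm //; split; field.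
  case: ifP => _.
    by rewrite cosDpi sinDpi; exact: (E 1 (or_introl erefl)).
  have -> : atan (y / x) - pi = - (- atan (y / x) + pi) by ring.
  rewrite cosN sinN cosDpi sinDpi cosN sinN opprK.
  by exact: (E 1 (or_introl erefl)).
- rewrite -x0 /hyp expr0n /= add0r sqrtr_sqr.
  case: (ltgtP 0 y) => y0.
  + by rewrite cos_pihalf sin_pihalf mulr0 mulr1 gtr0_norm.
  + by rewrite cosN sinN cos_pihalf sin_pihalf mulr0 mulrN1 ltr0_norm // opprK.
  + by rewrite -y0 normr0 !mul0r.
Qed.

(** The scalar product of [(x, y)] with the unit vector of angle [a]. *)
Lemma hypot_cosB x y a : hyp x y * cos (a - atan2 y x) = x * cos a + y * sin a.
Proof.
have [c s] := atan2_polar x y.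
by rewrite cosB mulrDr mulrCA c mulrCA s (mulrC (cos a)) (mulrC (sin a)).
Qed.

Lemma atan2_itv x y : - pi < atan2 y x <= pi.
Proof.
have pi0 := pi_gt0 R.
have a1 := atan_gtNpi2 (y / x); have a2 := atan_ltpi2 (y / x).
rewrite /atan2; case: (ltgtP 0 x) => x0.
- by apply/andP; split; lra.
- case: (leP 0 y) => y0.
    have : y / x <= 0 by rewrite nmulr_lle0 ?invr_lt0.
    move=> /le_atan; rewrite atan0 => ?; apply/andP; split; lra.
  have : 0 < y / x by rewrite nmulr_lgt0 ?invr_lt0.
  by move=> /lt_atan; rewrite atan0 => ?; apply/andP; split; lra.
- by case: (ltgtP 0 y) => y0; apply/andP; split; lra.
Qed.

Lemma hypot_gt0 x y : x != 0 \/ y != 0 -> 0 < hyp x y.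
Proof.
case=> h; rewrite sqrtr_gt0.
  by rewrite ltr_pwDl ?sqr_ge0 // exprn_even_gt0.
by rewrite ltr_wpDl ?sqr_ge0 // exprn_even_gt0.
Qed.

Lemma atan2_acos x y : 0 < y -> atan2 y x = acos (x / hyp x y).
Proof.
move=> y0; have n0 : 0 < hyp x y by apply: hypot_gt0; right; rewrite gt_eqF.
have [c s] := atan2_polar x y; have /andP[lo hi] := atan2_itv x y.
have -> : x / hyp x y = cos (atan2 y x) by rewrite -{1}c mulrAC mulfV ?mul1r // gt_eqF.
rewrite cosK // in_itv /= hi andbT leNgt; apply/negP => a0.
have : 0 <= sin (- atan2 y x) by apply: sin_ge0_pi; apply/andP; split; lra.
rewrite sinN oppr_ge0 => s0.
have : hyp x y * sin (atan2 y x) <= 0 by rewrite pmulr_rle0.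
by rewrite s leNgt y0.
Qed.

Lemma atan2_acosN x y : y < 0 -> atan2 y x = - acos (x / hyp x y).
Proof.
move=> y0; have n0 : 0 < hyp x y by apply: hypot_gt0; right; rewrite lt_eqF.
have [c s] := atan2_polar x y; have /andP[lo hi] := atan2_itv x y.
have -> : x / hyp x y = cos (atan2 y x) by rewrite -{1}c mulrAC mulfV ?mul1r // gt_eqF.
rewrite cosKN ?opprK // ltW //= leNgt; apply/negP => a0.
have : 0 <= sin (atan2 y x) by apply: sin_ge0_pi; apply/andP; split; lra.
move=> s0; have : 0 <= hyp x y * sin (atan2 y x) by rewrite pmulr_rge0.
by rewrite s leNgt y0.
Qed.

Lemma hypot_ratio_itv x y : y != 0 -> -1 < x / hyp x y < 1.
Proof.
move=> y0; have n0 : 0 < hyp x y by apply: hypot_gt0; right.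
rewrite -ltr_norml normrM normfV (gtr0_norm n0) ltr_pdivrMr // mul1r.
rewrite -sqrtr_sqr ltr_sqrt ?ltrDl ?exprn_even_gt0 //.
by rewrite ltr_wpDl ?sqr_ge0 // exprn_even_gt0.
Qed.

(** [atan2] is continuous off the half line [y = 0, x <= 0]: it is given by
    [atan] on the right half plane, and by [acos], up to sign, on the upper
    and lower half planes. *)
Lemma continuous_atan2 (x y : R -> R) (t : R) :
  {for t, continuous x} -> {for t, continuous y} -> 0 < x t \/ y t != 0 ->
  {for t, continuous (fun s => atan2 (y s) (x s))}.
Proof.
move=> xc yc xy.
have hc : hyp (x s) (y s) @[s --> t] --> hyp (x t) (y t).
  apply: (@continuous_comp _ _ _ (fun s => x s ^+ 2 + y s ^+ 2) Num.sqrt).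
    by apply: cvgD; rewrite expr2; under eq_fun do rewrite expr2; apply: cvgM.
  exact: sqrt_continuous.
have rc : y t != 0 -> x s / hyp (x s) (y s) @[s --> t] --> x t / hyp (x t) (y t).
  move=> y0; apply: cvgM => //; apply: cvgV => //.
  by rewrite gt_eqF // hypot_gt0 //; right.
have [x0|x0] := ltP 0 (x t).
  have E : \forall s \near t, atan (y s / x s) = atan2 (y s) (x s).
    near=> s; have x0' : 0 < x s by near: s; exact: (cvgr_gt (x t)).
    by rewrite /atan2 x0'.
  rewrite /prop_for /continuous_at (_ : atan2 (y t) (x t) = atan (y t / x t)).
    apply: cvg_trans; first exact: (near_eq_cvg E).
    apply: (@continuous_comp _ _ _ (fun s => y s / x s) atan).
      by apply: cvgM => //; apply: cvgV => //; rewrite gt_eqF.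
    exact: continuous_atan.
  by rewrite /atan2 x0.
have {xy} y0 : y t != 0 by case: xy => //; rewrite ltNge x0.
have acosc : acos (x s / hyp (x s) (y s)) @[s --> t] --> acos (x t / hyp (x t) (y t)).
  apply: (@continuous_comp _ _ _ (fun s => x s / hyp (x s) (y s)) acos).
    exact: rc.
  by apply: continuous_acos; exact: hypot_ratio_itv.
move: (y0); rewrite neq_lt => /orP[yneg|ypos].
  rewrite /prop_for /continuous_at atan2_acosN //.
  apply: cvg_trans (cvgN acosc).
  apply: near_eq_cvg; near=> s.
  by rewrite /= atan2_acosN //; near: s; exact: (cvgr_lt (y t)).
rewrite /prop_for /continuous_at atan2_acos //.
apply: cvg_trans acosc.
apply: near_eq_cvg; near=> s.
by rewrite /= atan2_acos //; near: s; exact: (cvgr_gt (y t)).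
Unshelve. all: by end_near.
Qed.

End Atan2.

(** * Pairwise forces, saturation and calculus *)

Section Configuration.
Context {R : realType} (N : nat) (E : rel 'I_N) (Phi G : R -> R).
Implicit Types x y z th : 'I_N -> R.

(** The squared length of the pair [(i, j)] in the configuration with
    coordinates [x] and [y]. *)
Definition sqdist x y (i j : 'I_N) : R := (x j - x i) ^+ 2 + (y j - y i) ^+ 2.

(** The attraction exerted on [i] along the coordinate [z] (which is [x] or
    [y]), where [G] is the derivative of the potential with respect to the
    squared distance. *)
Definition force x y z (i : 'I_N) : R :=
  \sum_(j < N | E i j) 2 * G (sqdist x y i j) * (z j - z i).

(** The unsaturated speed of agent [i]: the force projected on its heading. *)
Definition speed x y th (i : 'I_N) : R :=
  force x y x i * cos (th i) + force x y y i * sin (th i).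

(** The total potential, with [Phi] the potential as a function of the squared
    distance. *)
Definition energy x y : R :=
  2^-1 * \sum_(i < N) \sum_(j < N | E i j) Phi (sqdist x y i j).

Lemma sqdistC x y i j : sqdist x y i j = sqdist x y j i.
Proof. by rewrite /sqdist; ring. Qed.

Lemma sqdist_ge0 x y i j : 0 <= sqdist x y i j.
Proof. by rewrite addr_ge0 ?sqr_ge0. Qed.

Hypothesis Esym : symmetric E.

(** Summation by parts over the edges of an undirected graph. *)
Lemma sum_antisymmetric (F : 'I_N -> 'I_N -> R) (a : 'I_N -> R) :
  (forall i j, F i j = - F j i) ->
  \sum_(i < N) \sum_(j < N | E i j) F i j * (a j - a i) =
  - 2 * \sum_(i < N) (\sum_(j < N | E i j) F i j) * a i.
Proof.
move=> Fanti.
have swap : \sum_(i < N) \sum_(j < N | E i j) F i j * a j =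
    - \sum_(i < N) \sum_(j < N | E i j) F i j * a i.
  under eq_bigr do rewrite big_mkcond.
  rewrite exchange_big /= -sumrN; apply: eq_bigr => j _.
  rewrite -sumrN [RHS]big_mkcond /=; apply: eq_bigr => i _.
  by rewrite Esym; case: ifP => // _; rewrite Fanti mulNr.
rewrite (eq_bigr (fun i => \sum_(j < N | E i j) F i j * a j -
    \sum_(j < N | E i j) F i j * a i)); last first.
  by move=> i _; rewrite -sumrB; apply: eq_bigr => j _; rewrite mulrBr.
rewrite sumrB swap.
have -> : \sum_(i < N) \sum_(j < N | E i j) F i j * a i =
    \sum_(i < N) (\sum_(j < N | E i j) F i j) * a i.
  by apply: eq_bigr => i _; rewrite mulr_suml.
by ring.
Qed.

Let F x y z i j := 2 * G (sqdist x y i j) * (z j - z i).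

Let F_anti x y z i j : F x y z i j = - F x y z j i.
Proof. by rewrite /F sqdistC; ring. Qed.

Lemma sum_force x y z : \sum_(i < N) force x y z i = 0.
Proof.
have := sum_antisymmetric (fun=> 1) (F_anti x y z).
rewrite big1 => [|i _]; last by rewrite big1 // => j _; rewrite subrr mulr0.
under eq_bigr do rewrite mulr1.
move=> h; rewrite /force -[LHS]/(\sum_(i < N) \sum_(j < N | E i j) F x y z i j).
by lra.
Qed.

(** The power of the forces along the velocities [a], as a sum over edges. *)
Lemma sum_force_power x y z a :
  \sum_(i < N) force x y z i * a i =
  - \sum_(i < N) \sum_(j < N | E i j) G (sqdist x y i j) * (z j - z i) * (a j - a i).
Proof.
have := sum_antisymmetric a (F_anti x y z).
have -> : \sum_(i < N) \sum_(j < N | E i j) F x y z i j * (a j - a i) =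
   2 * \sum_(i < N) \sum_(j < N | E i j) G (sqdist x y i j) * (z j - z i) * (a j - a i).
  rewrite mulr_sumr; apply: eq_bigr => i _; rewrite mulr_sumr.
  by apply: eq_bigr => j _; rewrite /F; ring.
rewrite -[X in _ = _ * X -> _]/(\sum_(i < N) force x y z i * a i).
by lra.
Qed.

(** Each edge is counted twice in the double sum, which cancels the factor
    1/2; this is where irreflexivity matters. *)
Lemma edge_le_energy x y i j : irreflexive E -> E i j ->
  (forall a b, E a b -> 0 <= Phi (sqdist x y a b)) ->
  Phi (sqdist x y i j) <= energy x y.
Proof.
move=> Eirr Eij P0.
have ij : i != j by apply/eqP => ij; move: Eij; rewrite ij Eirr.
have row a b : E a b -> Phi (sqdist x y a b) <= \sum_(c < N | E a c) Phi (sqdist x y a c).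
  move=> Eab; rewrite (bigD1 b) //= lerDl sumr_ge0 // => c /andP[Eac _]; exact: P0.
have := row _ _ Eij; have := row j i; rewrite Esym => /(_ Eij).
rewrite (sqdistC x y j i) /energy.
set S := fun a => \sum_(b < N | E a b) Phi (sqdist x y a b).
rewrite -/(S i) -/(S j) -[X in 2^-1 * X]/(\sum_(a < N) S a).
rewrite (bigD1 i) //= (bigD1 j) /=; last by rewrite eq_sym.
set C := \sum_(_ < N | _) _.
have : 0 <= C.
  by apply: sumr_ge0 => a _; apply: sumr_ge0 => b; exact: P0.
by lra.
Qed.

End Configuration.

Section Sat.
Context {R : realType}.
Implicit Types lo hi x y : R.

Lemma sat_itv lo hi x : lo < 0 < hi -> lo <= sat lo hi x <= hi.
Proof.
move=> /andP[l h]; rewrite /sat; case: ifP => [|/negbT]; rewrite -?leNgt => ?.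
  by apply/andP; split; lra.
by case: ifP => [|/negbT]; rewrite -?leNgt => ?; apply/andP; split; lra.
Qed.

Lemma sat_lipschitz lo hi x y : lo < 0 < hi -> `|sat lo hi x - sat lo hi y| <= `|x - y|.
Proof.
move=> /andP[l h]; rewrite /sat ler_norml.
have := ler_norm (x - y); have := ler_norm (- (x - y)); rewrite normrN.
have := normr_ge0 (x - y).
case: (ltP x lo) => ?; case: (ltP y lo) => ?; case: (ltP hi x) => ?;
  case: (ltP hi y) => ?; move=> *; apply/andP; split; lra.
Qed.

Lemma sat_pos lo hi x m : m <= hi -> lo < 0 -> 0 <= m -> m <= x -> m <= sat lo hi x.
Proof.
move=> ? ? ? ?; rewrite /sat; case: (ltP x lo) => ?; first lra.
by case: (ltP hi x) => ?; lra.
Qed.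

Lemma sat_neg lo hi x m : lo <= - m -> 0 < hi -> 0 <= m -> x <= - m -> sat lo hi x <= - m.
Proof.
move=> ? ? ? ?; rewrite /sat; case: (ltP x lo) => ?; first lra.
by case: (ltP hi x) => ?; lra.
Qed.

Lemma mul_sat_ge0 lo hi x : lo < 0 < hi -> 0 <= x * sat lo hi x.
Proof.
move=> /andP[l h]; case: (leP 0 x) => x0.
  by rewrite mulr_ge0 // (sat_pos (m := 0)) // ltW.
apply: mulr_le0; first exact: ltW.
by have := @sat_neg lo hi x 0; rewrite oppr0; apply=> //; exact: ltW.
Qed.

Lemma mul_sat_ge lo hi x m : lo <= - m -> m <= hi -> 0 < m -> m <= `|x| ->
  m * m <= x * sat lo hi x.
Proof.
move=> l h m0; case: (leP 0 x) => x0.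
  rewrite ger0_norm // => mx; apply: ler_pM => //; try exact: ltW.
  by apply: sat_pos => //; lra.
rewrite ltr0_norm // => mx; rewrite -[leRHS]mulrNN; apply: ler_pM; try lra.
by rewrite lerNr; apply: sat_neg => //; lra.
Qed.

End Sat.

Section Calculus.
Context {R : realType}.

Lemma is_derive_bigsum (I : finType) (P : pred I) (f : I -> R -> R) (df : I -> R) (t : R) :
  (forall i, P i -> is_derive t 1 (f i) (df i)) ->
  is_derive t 1 (fun s => \sum_(i | P i) f i s) (\sum_(i | P i) df i).
Proof.
move=> fdf; rewrite (_ : (fun s => _) = \sum_(i | P i) f i); last first.
  by apply/funext => s; rewrite fct_sumE.
elim/big_rec2: _ => [|i d F Pi dF]; first exact: is_derive_cst.
by apply: is_deriveD; exact: fdf.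
Qed.

Lemma is_derive_sqr (f : R -> R) (df t : R) : is_derive t 1 f df ->
  is_derive t 1 (fun s => f s ^+ 2) (2 * f t * df).
Proof.
move=> fdf; have := is_deriveM fdf fdf.
rewrite (_ : f * f = fun s => f s ^+ 2); last by apply/funext => s; rewrite expr2.
by move=> h; apply: (is_derive_eq h); rewrite /GRing.scale /=; ring.
Qed.

(** A function extended by its initial value to the negative times is Lipschitz
    there too, which makes continuity at time 0 two-sided. *)
Lemma extended_lipschitz (f : R -> R) (M : R) : 0 <= M ->
  (forall t, t <= 0 -> f t = f 0) ->
  (forall s t, 0 <= s -> 0 <= t -> `|f s - f t| <= M * `|s - t|) ->
  forall s t, `|f s - f t| <= M * `|s - t|.
Proof.
move=> M0 f0 fM s t.
have fE u : f u = f (Num.max 0 u) by case: (leP 0 u) => // /ltW/f0.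
rewrite fE (fE t); apply: le_trans (fM _ _ _ _) _; rewrite ?le_max ?lexx //.
apply: ler_wpM2l => //.
have := ler_norm (s - t); have := ler_norm (- (s - t)); rewrite normrN.
have := normr_ge0 (s - t); rewrite ler_norml.
by case: (leP 0 s) => ?; case: (leP 0 t) => ? *; apply/andP; split; lra.
Qed.

Lemma lipschitz_continuous (f : R -> R) (M : R) :
  (forall s t, `|f s - f t| <= M * `|s - t|) -> continuous f.
Proof.
move=> fM t; have M1 : 0 < `|M| + 1 by rewrite ltr_wpDl.
apply/cvgrPdist_le => e e0; near=> s.
apply: le_trans (fM _ _) _.
apply: (@le_trans _ _ ((`|M| + 1) * `|t - s|)).
  rewrite ler_wpM2r // (le_trans (ler_norm _)) //; lra.
rewrite mulrC -ler_pdivlMr //; near: s.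
by apply: cvgr_dist_le; [exact: cvg_id | rewrite divr_gt0].
Unshelve. all: by end_near.
Qed.

End Calculus.

(** * The closed loop: connectivity and consensus *)

Section ClosedLoop.
Context {R : realType} (N : nat) (E : rel 'I_N).
Hypotheses (Esym : symmetric E) (Eirr : irreflexive E).
Variables (Phi G : R -> R) (r2 : R).
Hypothesis Phi_ge0 : forall u, 0 <= u -> u < r2 -> 0 <= Phi u.
Hypothesis dPhi : forall u, u < r2 -> is_derive u 1 Phi (G u).
Hypothesis G_gt0 : forall u, u < r2 -> 0 < G u.
Hypothesis G_cont : forall u, u < r2 -> {for u, continuous G}.
Variables (vlo vhi wlo whi : 'I_N -> R) (k : R).
Hypothesis vlim : forall i, vlo i < 0 < vhi i.
(* The trajectories are extended by their initial values to the negative times;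
   gv and gw are the saturated linear and angular speeds. *)
Variables (x y th gv gw : R -> 'I_N -> R) (M : R).
Hypothesis x_past : forall i t, t <= 0 -> x t i = x 0 i.
Hypothesis y_past : forall i t, t <= 0 -> y t i = y 0 i.
Hypothesis th_past : forall i t, t <= 0 -> th t i = th 0 i.
Hypothesis gv_bounded : forall i t, 0 <= t -> `|gv t i| <= M.
Hypothesis gw_bounded : forall i t, 0 <= t -> `|gw t i| <= M.
Hypothesis x_rate : forall i, has_rate (x ^~ i) (fun t => gv t i * cos (th t i)).
Hypothesis y_rate : forall i, has_rate (y ^~ i) (fun t => gv t i * sin (th t i)).
Hypothesis th_rate : forall i, has_rate (th ^~ i) (gw ^~ i).

(** Every edge is shorter than the communication radius, [r2] being its
    square. *)
Definition linked (t : R) : Prop := forall i j, E i j -> sqdist (x t) (y t) i j < r2.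

Let V t := energy E Phi (x t) (y t).
Let s t := speed E G (x t) (y t) (th t).
Let W t := \sum_(i < N) s t i * sat (vlo i) (vhi i) (s t i).

Hypothesis gvE : forall i t, 0 <= t -> linked t -> gv t i = sat (vlo i) (vhi i) (s t i).
Hypothesis linked0 : linked 0.
Variable rho2 : R.
(* Energies up to the initial one confine the squared lengths to [0, rho2]. *)
Hypothesis rho2_lt : rho2 < r2.
Hypothesis barrier : forall u, 0 <= u -> u < r2 -> Phi u <= V 0 -> u <= rho2.

Lemma M_ge0 (i : 'I_N) : 0 <= M.
Proof. exact: le_trans (gv_bounded i (lexx 0)). Qed.

Lemma x_lipschitz i t u : `|x t i - x u i| <= M * `|t - u|.
Proof.
apply: (extended_lipschitz (M_ge0 i) (x_past i)) => {t u}.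
apply: (has_rate_lipschitz (x_rate i)) => t t0.
by rewrite normrM -[leRHS]mulr1 ler_pM ?gv_bounded ?cos_max.
Qed.

Lemma y_lipschitz i t u : `|y t i - y u i| <= M * `|t - u|.
Proof.
apply: (extended_lipschitz (M_ge0 i) (y_past i)) => {t u}.
apply: (has_rate_lipschitz (y_rate i)) => t t0.
by rewrite normrM -[leRHS]mulr1 ler_pM ?gv_bounded ?sin_max.
Qed.

Lemma th_lipschitz i t u : `|th t i - th u i| <= M * `|t - u|.
Proof.
apply: (extended_lipschitz (M_ge0 i) (th_past i)) => {t u}.
by apply: (has_rate_lipschitz (th_rate i)) => t t0; exact: gw_bounded.
Qed.

Lemma x_cont i : continuous (x ^~ i).
Proof. exact: lipschitz_continuous (x_lipschitz i). Qed.

Lemma y_cont i : continuous (y ^~ i).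
Proof. exact: lipschitz_continuous (y_lipschitz i). Qed.

Lemma th_cont i : continuous (th ^~ i).
Proof. exact: lipschitz_continuous (th_lipschitz i). Qed.

Lemma sqdist_cont i j : continuous (fun t => sqdist (x t) (y t) i j).
Proof.
move=> t; rewrite /sqdist.
by apply: cvgD; rewrite expr2; under eq_fun do rewrite expr2;
  apply: cvgM; apply: cvgB; (exact: x_cont || exact: y_cont).
Qed.

Lemma cvg_sum_at (I : finType) (P : pred I) (f : I -> R -> R) (t : R) :
  (forall i, P i -> {for t, continuous (f i)}) ->
  {for t, continuous (fun u => \sum_(i | P i) f i u)}.
Proof.
move=> fc; rewrite (_ : (fun u => _) = \sum_(i | P i) f i); last first.
  by apply/funext => u; rewrite fct_sumE.
elim/big_rec: _ => [|i F Pi cF]; first exact: cvg_cst.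
by apply: cvgD => //; exact: fc.
Qed.

Lemma near_linked t : linked t -> \forall u \near t, linked u.
Proof.
move=> tl.
pose near_edge (p : 'I_N * 'I_N) u := E p.1 p.2 -> sqdist (x u) (y u) p.1 p.2 < r2.
have near_all p : \forall u \near t, near_edge p u.
  case: p => i j; case Eij: (E i j); near=> u; rewrite /near_edge /= Eij // => _.
  by near: u; exact: (cvgr_lt _ (@sqdist_cont i j t) _ (tl _ _ Eij)).
near=> u => i j.
have : forall p, near_edge p u by near: u; exact: filter_forall near_all.
by move=> /(_ (i, j)).
Unshelve. all: by end_near.
Qed.

Lemma force_cont z i t : linked t -> (forall i, continuous (z ^~ i)) ->
  {for t, continuous (fun u => force E G (x u) (y u) (z u) i)}.
Proof.
move=> tl zc; apply: cvg_sum_at => j Eij.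
apply: cvgM; last by apply: cvgB; exact: zc.
apply: cvgM; first exact: cvg_cst.
apply: (@continuous_comp _ _ _ (fun u => sqdist (x u) (y u) i j) G).
  exact: sqdist_cont.
by apply: G_cont; exact: tl.
Qed.

Lemma speed_cont i t : linked t -> {for t, continuous (s ^~ i)}.
Proof.
move=> tl; apply: cvgD; apply: cvgM.
- exact: force_cont tl x_cont.
- by apply: (@continuous_comp _ _ _ (th ^~ i) cos); [exact: th_cont | exact: continuous_cos].
- exact: force_cont tl y_cont.
- by apply: (@continuous_comp _ _ _ (th ^~ i) sin); [exact: th_cont | exact: continuous_sin].
Qed.

Lemma sat_cont i : continuous (sat (vlo i) (vhi i)).
Proof.
apply: (@lipschitz_continuous _ _ 1) => u v; rewrite mul1r; exact: sat_lipschitz.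
Qed.

Lemma gv_cont i t : 0 < t -> linked t -> {for t, continuous (gv ^~ i)}.
Proof.
move=> t0 tl; rewrite /prop_for /continuous_at (gvE i (ltW t0) tl).
have E1 : {near t, (fun u => sat (vlo i) (vhi i) (s u i)) =1 (gv ^~ i)}.
  near=> u; rewrite gvE //.
    by apply: ltW; near: u; exact: lt_nbhsr.
  by near: u; exact: near_linked.
apply: cvg_trans; first exact: (near_eq_cvg E1).
apply: (@continuous_comp _ _ _ (s ^~ i) (sat (vlo i) (vhi i))).
  exact: speed_cont.
exact: sat_cont.
Unshelve. all: by end_near.
Qed.

(** The positions, unlike the orientations, are continuously differentiable:
    the saturated speed depends continuously on the state. *)
Lemma energy_derive t : 0 < t -> linked t -> is_derive t 1 V (- W t).
Proof.
move=> t0 tl.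
have dx i : is_derive t 1 (x ^~ i) (gv t i * cos (th t i)).
  apply: (has_rate_derive (x_rate i) t0); apply: cvgM; first exact: gv_cont.
  by apply: (@continuous_comp _ _ _ (th ^~ i) cos); [exact: th_cont | exact: continuous_cos].
have dy i : is_derive t 1 (y ^~ i) (gv t i * sin (th t i)).
  apply: (has_rate_derive (y_rate i) t0); apply: cvgM; first exact: gv_cont.
  by apply: (@continuous_comp _ _ _ (th ^~ i) sin); [exact: th_cont | exact: continuous_sin].
pose dX i := gv t i * cos (th t i); pose dY i := gv t i * sin (th t i).
pose D i j := 2 * (x t j - x t i) * (dX j - dX i) + 2 * (y t j - y t i) * (dY j - dY i).
have dd i j : is_derive t 1 (fun u => sqdist (x u) (y u) i j) (D i j).
  apply: is_deriveD; apply: is_derive_sqr; exact: is_deriveB.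
have dV : is_derive t 1 V
    (2^-1 * \sum_(i < N) \sum_(j < N | E i j) G (sqdist (x t) (y t) i j) * D i j).
  apply: (@is_deriveZ R R^o R^o) => //.
  apply: is_derive_bigsum => i _; apply: is_derive_bigsum => j Eij.
  apply: (@is_derive1_comp R Phi (fun u => sqdist (x u) (y u) i j)).
  by apply: dPhi; exact: tl.
apply: (is_derive_eq dV).
have WE : W t = \sum_(i < N) force E G (x t) (y t) (x t) i * dX i +
    \sum_(i < N) force E G (x t) (y t) (y t) i * dY i.
  rewrite -big_split; apply: eq_bigr => i _ /=.
  by rewrite -gvE // ?ltW // /s /speed /dX /dY; ring.
rewrite WE !sum_force_power // opprD !opprK -big_split mulr_sumr; apply: eq_bigr => i _ /=.
rewrite -big_split mulr_sumr; apply: eq_bigr => j _ /=.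
by rewrite /D; field.
Qed.

Lemma V_cont t : linked t -> {for t, continuous V}.
Proof.
move=> tl; apply: cvgM; first exact: cvg_cst.
apply: cvg_sum_at => i _; apply: cvg_sum_at => j Eij.
apply: (@continuous_comp _ _ _ (fun u => sqdist (x u) (y u) i j) Phi).
  exact: sqdist_cont.
have dP := dPhi (tl _ _ Eij).
by apply/differentiable_continuous/derivable1_diffP; exact: ex_derive.
Qed.

Lemma W_ge0 t : 0 <= W t.
Proof. by apply: sumr_ge0 => i _; exact: mul_sat_ge0. Qed.

Lemma V_le_init t : 0 <= t -> (forall u, 0 <= u -> u <= t -> linked u) -> V t <= V 0.
Proof.
move=> t0 ul.
have d u : u \in `]0, t[ -> is_derive u 1 V (- W u).
  by rewrite in_itv /= => /andP[u0 ut]; apply: energy_derive (u0) _; apply: ul; exact: ltW.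
apply: (@ler0_derive1_nincr R V 0 t) => //.
- by move=> u /d du; exact: ex_derive.
- by move=> u /d du; rewrite derive1E derive_val oppr_le0 W_ge0.
- apply: continuous_in_subspaceT => u; rewrite inE /= in_itv /= => /andP[u0 ut].
  by apply: V_cont; exact: ul.
Qed.

Lemma sqdist_le_rho2 t : linked t -> V t <= V 0 ->
  forall i j, E i j -> sqdist (x t) (y t) i j <= rho2.
Proof.
move=> tl Vt i j Eij; apply: barrier; first exact: sqdist_ge0.
  exact: tl.
apply: le_trans Vt; apply: edge_le_energy => // a b Eab.
by apply: Phi_ge0; [exact: sqdist_ge0 | exact: tl].
Qed.

(** No first time at which an edge reaches the communication radius: until
    that time the energy has not exceeded its initial value, so by the barrier
    every edge has stayed at distance at most rho2 from the start. *)
Lemma always_linked t : 0 <= t -> linked t.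
Proof.
move=> t0; apply: contrapT => tnl.
pose B := [set u | 0 <= u /\ ~ linked u].
have Bi : has_inf B by split; [exists t | exists 0 => u []].
have T0 : 0 <= inf B by apply: lb_le_inf; [exists t | move=> u []].
have before u : 0 <= u -> u < inf B -> linked u.
  move=> u0 uT; apply: contrapT => unl.
  by move: uT; rewrite ltNge => /negP; apply; apply: ge_inf => //; exact: Bi.2.
have TL : linked (inf B).
  have [->//|Tpos] := eqVneq (inf B) 0.
  have {}Tpos : 0 < inf B by rewrite lt_neqAle eq_sym Tpos.
  move=> i j Eij; apply: le_lt_trans rho2_lt.
  have c := cvg_at_left_filter (@sqdist_cont i j (inf B)).
  apply: (cvgr_to_le c).
  near=> u.
  have u0 : 0 <= u by near: u; exact: nbhs_left_ge.
  have uT : u < inf B by near: u; exact: nbhs_left_lt.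
  apply: sqdist_le_rho2 => //; first exact: before.
  by apply: V_le_init => // w w0 wu; apply: before => //; exact: le_lt_trans uT.
have [e /= e0 near_T] := near_linked TL.
have [u [u0 unl] uT] := inf_adherent e0 Bi.
apply: (unl); apply: near_T => /=.
have : inf B <= u by apply: ge_inf => //; exact: Bi.2.
by rewrite ltr_norml => ?; apply/andP; split; lra.
Unshelve. all: by end_near.
Qed.

Lemma V_le0 t : 0 <= t -> V t <= V 0.
Proof. by move=> t0; apply: V_le_init => // u u0 _; exact: always_linked. Qed.

Lemma edges_bounded t i j : 0 <= t -> E i j -> sqdist (x t) (y t) i j <= rho2.
Proof. by move=> t0; apply: sqdist_le_rho2; [exact: always_linked | exact: V_le0]. Qed.


Hypotheses (k_gt0 : 0 < k) (wlim : forall i, wlo i < 0 < whi i).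
Hypothesis Econn : forall i j, connect E i j.
Hypothesis th_itv : forall i t, 0 <= t -> - pi < th t i <= pi.

Let ux t := force E G (x t) (y t) (x t).
Let uy t := force E G (x t) (y t) (y t).

Hypothesis gwE : forall i t, 0 <= t -> linked t ->
  gw t i = sat (wlo i) (whi i) (- k * (th t i - atan2 (uy t i) (ux t i))).

Lemma sqr_le_abs (a b : R) : a ^+ 2 <= b -> `|a| <= 1 + b.
Proof.
move=> ab; have := sqr_ge0 (`|a| - 1); rewrite sqrrB1 real_normK ?num_real //.
have := normr_ge0 a; have := sqr_ge0 a; lra.
Qed.

Lemma edge_x_bounded i j t : E i j -> 0 <= t -> `|x t j - x t i| <= 1 + rho2.
Proof.
move=> Eij t0; apply: sqr_le_abs; have := edges_bounded t0 Eij.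
by rewrite /sqdist; have := sqr_ge0 (y t j - y t i); lra.
Qed.

Lemma edge_y_bounded i j t : E i j -> 0 <= t -> `|y t j - y t i| <= 1 + rho2.
Proof.
move=> Eij t0; apply: sqr_le_abs; have := edges_bounded t0 Eij.
by rewrite /sqdist; have := sqr_ge0 (x t j - x t i); lra.
Qed.

Lemma small_osc_force U z i : oscillation_scale U ->
  (forall i j, E i j -> small_osc U (fun t => x t j - x t i)) ->
  (forall i j, E i j -> small_osc U (fun t => y t j - y t i)) ->
  (forall i j, E i j -> small_osc U (fun t => z t j - z t i)) ->
  small_osc U (fun t => force E G (x t) (y t) (z t) i).
Proof.
move=> Us sx sy sz; apply: small_osc_sum => // j Eij.
apply: small_oscM => //; last exact: sz.
apply: small_oscM => //; first exact: small_osc_cst.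
apply: (@small_osc_comp _ U Us G 0 rho2 (fun t => sqdist (x t) (y t) i j)).
- by move=> u; rewrite in_itv /= => /andP[_ u_le]; apply: G_cont; exact: le_lt_trans rho2_lt.
- by move=> t t0; rewrite in_itv /= sqdist_ge0 edges_bounded.
- have sxx := small_oscM Us (sx _ _ Eij) (sx _ _ Eij).
  have syy := small_oscM Us (sy _ _ Eij) (sy _ _ Eij).
  by apply: (small_osc_ext Us _ (small_oscD Us sxx syy)) => t _; rewrite /sqdist !expr2.
Qed.

Lemma diff_lipschitz (z : R -> 'I_N -> R) i j :
  (forall i t u, `|z t i - z u i| <= M * `|t - u|) ->
  forall t u, `|(z t j - z t i) - (z u j - z u i)| <= (M + M) * `|t - u|.
Proof.
move=> zM t u; rewrite (_ : _ - _ = (z t j - z u j) - (z t i - z u i)); last by ring.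
by rewrite (le_trans (ler_normB _ _)) // mulrDl lerD.
Qed.

Lemma uniform_speed i : small_osc close_times (s ^~ i).
Proof.
have Us := close_times_scale (R := R).
have sx a b : E a b -> small_osc close_times (fun t => x t b - x t a).
  move=> Eab; apply: (small_osc_lipschitz (M := 1 + rho2)).
    by move=> t; exact: edge_x_bounded.
  exact: diff_lipschitz x_lipschitz.
have sy a b : E a b -> small_osc close_times (fun t => y t b - y t a).
  move=> Eab; apply: (small_osc_lipschitz (M := 1 + rho2)).
    by move=> t; exact: edge_y_bounded.
  exact: diff_lipschitz y_lipschitz.
have sth : small_osc close_times (th ^~ i).
  apply: (small_osc_lipschitz (M := pi) _ (th_lipschitz i)) => t t0.
  by have /andP[lo hi] := th_itv i t0; rewrite ler_norml hi ltW.
apply: small_oscD => //; apply: small_oscM => //.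
- exact: small_osc_force.
- exact: (small_osc_continuous Us (@continuous_cos R) sth).
- exact: small_osc_force.
- exact: (small_osc_continuous Us (@continuous_sin R) sth).
Qed.

Lemma W_vanishing : vanishing W.
Proof.
apply: (@Barbalat _ V W).
- apply: small_osc_sum => [|i _]; first exact: close_times_scale.
  apply: small_oscM; [exact: close_times_scale|exact: uniform_speed|].
  exact: (small_osc_continuous (close_times_scale (R := R)) (sat_cont (i := i)) (uniform_speed i)).
- by move=> t _; exact: W_ge0.
- move=> t t0; rewrite mulr_ge0 // sumr_ge0 // => i _; rewrite sumr_ge0 // => j Eij.
  by apply: Phi_ge0; [exact: sqdist_ge0 | exact: always_linked].
- by move=> t t0; apply: V_cont; exact: always_linked.
- by move=> t t0; apply: energy_derive => //; apply: always_linked; exact: ltW.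
Qed.

Lemma speed_vanishing i : vanishing (s ^~ i).
Proof.
move=> e e0; have /andP[l h] := vlim i.
pose m := Num.min e (Num.min (- vlo i) (vhi i)).
have m0 : 0 < m by rewrite !lt_min e0 oppr_gt0 l h.
have [me mlo mhi] : [/\ m <= e, m <= - vlo i & m <= vhi i].
  by rewrite /m !ge_min !lexx !orbT.
have [T T0 WT] := W_vanishing (mulr_gt0 m0 m0).
exists T => // t Tt; rewrite ltNge; apply/negP => es.
have := WT t Tt; rewrite ger0_norm ?W_ge0 // ltNge => /negP; apply.
apply: (@le_trans _ _ (s t i * sat (vlo i) (vhi i) (s t i))).
  by apply: mul_sat_ge => //; [rewrite lerNr | exact: le_trans es].
rewrite /W (bigD1 i) //= lerDl sumr_ge0 // => j _; exact: mul_sat_ge0.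
Qed.

Lemma gv_vanishing i : vanishing (gv ^~ i).
Proof.
move=> e /(speed_vanishing i)[T T0 sT]; exists T => // t Tt.
have t0 : 0 <= t by exact: le_trans Tt.
rewrite gvE //; last exact: always_linked.
apply: le_lt_trans (sT t Tt).
have /andP[l h] := vlim i.
have s0 : sat (vlo i) (vhi i) 0 = 0 by rewrite /sat ltNge (ltW l) /= ltNge (ltW h).
by have := sat_lipschitz (s t i) 0 (vlim i); rewrite s0 !subr0.
Qed.

(** Over windows of any fixed length the agents eventually hardly move. *)
Lemma slow_motion (z : R -> 'I_N -> R) (c : R -> R) i tau :
  vanishing (gv ^~ i) -> (forall t, `|c t| <= 1) ->
  has_rate (z ^~ i) (fun t => gv t i * c t) -> 0 < tau ->
  forall e, 0 < e -> exists2 d, 0 < d &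
    forall t u, late_window tau d t u -> `|z t i - z u i| < e.
Proof.
move=> gv0 c1 zr tau0 e e0.
have et : 0 < e / 2 / tau by rewrite !divr_gt0.
have [T T0 gT] := gv0 _ et.
have T1 : 0 < T + 1 by lra.
exists (T + 1)^-1; first by rewrite invr_gt0.
move=> t u [_]; rewrite invrK => Tt tu ut.
have t0 : 0 <= t by lra.
have rate w : t <= w <= u -> - (e / 2 / tau) <= gv w i * c w <= e / 2 / tau.
  case/andP=> tw _; rewrite -ler_norml normrM -[leRHS]mulr1 ler_pM //.
  by apply: ltW; apply: gT; lra.
have [lo _] := zr t u (- (e / 2 / tau)) t0 tu.
have [_ hi] := zr t u (e / 2 / tau) t0 tu.
have {}lo := lo (fun w hw => (andP (rate w hw)).1).
have {}hi := hi (fun w hw => (andP (rate w hw)).2).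
have : e / 2 / tau * (u - t) <= e / 2.
  rewrite -[leRHS](divfK (lt0r_neq0 tau0)) ler_wpM2l ?(ltW et) //; lra.
move: lo; rewrite mulNr => lo b.
rewrite distrC (@le_lt_trans _ _ (e / 2)) //; last by lra.
by rewrite ler_norml; apply/andP; split; lra.
Qed.

Lemma slow_diff (z c : R -> 'I_N -> R) tau i j : 0 < tau ->
  (forall i t, `|c t i| <= 1) ->
  (forall i, has_rate (z ^~ i) (fun t => gv t i * c t i)) ->
  (forall t, 0 <= t -> `|z t j - z t i| <= 1 + rho2) ->
  small_osc (late_window tau) (fun t => z t j - z t i).
Proof.
move=> tau0 c1 zr zb; split; first by exists (1 + rho2).
move=> e e0; have e2 : 0 < e / 2 by rewrite divr_gt0.
have [d d0 di] := slow_motion (gv_vanishing i) (c1 i) (zr i) tau0 e2.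
have [d' d'0 dj] := slow_motion (gv_vanishing j) (c1 j) (zr j) tau0 e2.
have Us := late_window_scale tau.
exists (Num.min d d'); first by rewrite lt_min d0.
move=> t u tu.
have tud : late_window tau d t u by apply: Us.1 tu; rewrite ge_min lexx.
have tud' : late_window tau d' t u by apply: Us.1 tu; rewrite ge_min lexx orbT.
rewrite (_ : _ - _ = (z t j - z u j) - (z t i - z u i)); last by ring.
by rewrite (splitr e) (le_lt_trans (ler_normB _ _)) // ltrD ?di ?dj.
Qed.

Lemma slow_x tau i j : 0 < tau -> E i j ->
  small_osc (late_window tau) (fun t => x t j - x t i).
Proof.
move=> tau0 Eij; apply: (slow_diff (c := fun t i => cos (th t i))) => //.
- by move=> ? ?; exact: cos_max.
- by move=> t; exact: edge_x_bounded.
Qed.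

Lemma slow_y tau i j : 0 < tau -> E i j ->
  small_osc (late_window tau) (fun t => y t j - y t i).
Proof.
move=> tau0 Eij; apply: (slow_diff (c := fun t i => sin (th t i))) => //.
- by move=> ? ?; exact: sin_max.
- by move=> t; exact: edge_y_bounded.
Qed.

Lemma constant_sign (f : R -> R) (a b m : R) : 0 < m -> a <= b ->
  (forall u, a <= u <= b -> {for u, continuous f}) ->
  (forall u, a <= u <= b -> m <= `|f u|) ->
  (forall u, a <= u <= b -> m <= f u) \/ (forall u, a <= u <= b -> f u <= - m).
Proof.
move=> m0 ab fc fm.
have ivt u : a <= u <= b -> ~ (Num.min (f a) (f u) <= 0 <= Num.max (f a) (f u)).
  move=> /andP[au ub] f0.
  have wc : {within `[a, u], continuous f}.
    apply: continuous_in_subspaceT => w; rewrite inE /= in_itv /= => /andP[aw wu].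
    by apply: fc; rewrite aw (le_trans wu).
  have [w] := IVT au wc f0; rewrite in_itv /= => /andP[aw wu] fw.
  have := fm w; rewrite aw (le_trans wu) //= fw normr0 => /(_ isT); lra.
have faM := fm a; rewrite lexx ab in faM; have {}faM := faM isT.
have [fa0|fa0] := leP 0 (f a).
  left=> u aub; have := fm u aub; have := ivt u aub.
  have [fu0|fu0] := leP 0 (f u); first by rewrite ger0_norm.
  by rewrite le_max fa0 ge_min (ltW fu0) orbT => /(_ isT).
right=> u aub; have := fm u aub; have := ivt u aub.
have [fu0|fu0] := leP 0 (f u).
  by rewrite le_max fu0 orbT ge_min (ltW fa0) => /(_ isT).
by rewrite ltr0_norm // lerNr.
Qed.

Lemma speed_polar t i :
  s t i = Num.sqrt (ux t i ^+ 2 + uy t i ^+ 2) * cos (th t i - atan2 (uy t i) (ux t i)).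
Proof.
by rewrite hypot_cosB.
Qed.

Lemma le_abs_of_cos_lt (a : R) : `|cos a| < cos (pi / 4) -> pi / 4 <= `|a|.
Proof.
move=> ca; rewrite leNgt; apply/negP => a_lt.
have pi0 := pi_gt0 R.
have : cos (pi / 4) < cos `|a|.
  have a0 := normr_ge0 a.
  by rewrite ltr_cos // in_itv /=; apply/andP; split; lra.
rewrite cos_norm => h; have := ler_norm (cos a); lra.
Qed.

(** A force that is away from the cut of [atan2] at a late time is so during a
    long window. The speed being small there, the heading error keeps a constant
    sign and a size at least [pi / 4], hence the agent turns in one direction by
    more than a full turn, which the range of the orientation excludes. *)
Lemma force_near_cut i e : 0 < e ->
  exists2 T, 0 <= T & forall t, T <= t -> ux t i < e /\ `|uy t i| < e.
Proof.
move=> e0; have pi0 := pi_gt0 R; have /andP[wl wh] := wlim i.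
pose c := Num.min (k * (pi / 4)) (Num.min (- wlo i) (whi i)).
have c0 : 0 < c by rewrite !lt_min oppr_gt0 wl wh mulr_gt0 // divr_gt0.
have [ck clo chi] : [/\ c <= k * (pi / 4), c <= - wlo i & c <= whi i].
  by rewrite /c !ge_min !lexx !orbT.
(* c bounds the turning rate from below; a window of length tau allows for
   more than a full turn. *)
pose tau := (pi * 2 + 1) / c.
have tau0 : 0 < tau by rewrite divr_gt0 //; lra.
have ctau : c * tau = pi * 2 + 1 by rewrite /tau mulrC divfK // gt_eqF.
have e2 : 0 < e / 2 by rewrite divr_gt0.
have cos0 : 0 < cos (pi / 4 : R) by apply: cos_gt0_pihalf; apply/andP; split; lra.
have Us := late_window_scale tau.
have sx a b : E a b -> small_osc (late_window tau) (fun t => x t b - x t a) by exact: slow_x.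
have sy a b : E a b -> small_osc (late_window tau) (fun t => y t b - y t a) by exact: slow_y.
have [_ /(_ _ e2)[d1 d10 slow1]] := small_osc_force i Us sx sy sx.
have [_ /(_ _ e2)[d2 d20 slow2]] := small_osc_force i Us sx sy sy.
have [T T0 sT] := @speed_vanishing i _ (mulr_gt0 e2 cos0).
exists (Num.max T (Num.max d1^-1 d2^-1)) => [|t]; first by rewrite le_max T0.
rewrite !ge_max => /and3P[Tt d1t d2t].
have t0 : 0 <= t by exact: le_trans Tt.
suff far : ~ (e <= ux t i \/ e <= `|uy t i|).
  by split; rewrite ltNge; apply/negP => h; apply: far; [left|right].
move=> far.
have close u : t <= u <= t + tau -> `|ux t i - ux u i| < e / 2 /\ `|uy t i - uy u i| < e / 2.
  by move=> /andP[tu ut]; split; [apply: slow1 | apply: slow2].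
have off u : t <= u <= t + tau -> e / 2 < ux u i \/ e / 2 < `|uy u i|.
  move=> /close[hx hy]; case: far => h; [left|right].
    by move: hx; rewrite ltr_norml => /andP[_]; lra.
  by have := ler_distD 0 (uy t i) (uy u i); have := lerB_dist (uy t i) (uy u i); lra.
pose tt u := th u i - atan2 (uy u i) (ux u i).
have u_ge0 u : t <= u <= t + tau -> 0 <= u by move=> /andP[tu _]; exact: le_trans tu.
have ttc u : t <= u <= t + tau -> {for u, continuous tt}.
  move=> htu; have ul := always_linked (u_ge0 u htu).
  apply: cvgB; first exact: th_cont.
  apply: (@continuous_atan2 R (ux ^~ i) (uy ^~ i)).
  - exact: force_cont ul x_cont.
  - exact: force_cont ul y_cont.
  - case: (off u htu) => h; [left; lra | right].
    by rewrite -normr_gt0; lra.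
have tt_big u : t <= u <= t + tau -> pi / 4 <= `|tt u|.
  move=> htu; apply: le_abs_of_cos_lt; rewrite ltNge; apply/negP => h.
  have := sT u; have /andP[tu _] := htu; move=> /(_ (le_trans Tt tu)).
  rewrite /= speed_polar ltNge normrM => /negP; apply.
  apply: ler_pM => //; [exact: ltW | exact: ltW |].
  rewrite ger0_norm ?sqrtr_ge0 //.
  rewrite [leLHS](_ : _ = Num.sqrt ((e / 2) ^+ 2)); last by rewrite sqrtr_sqr gtr0_norm.
  rewrite ler_wsqrtr //.
  case: (off u htu) => hb.
    have : (e / 2) ^+ 2 <= ux u i ^+ 2 by rewrite ler_pXn2r // ?nnegrE ?ltW //; lra.
    by have := sqr_ge0 (uy u i); lra.
  have : (e / 2) ^+ 2 <= uy u i ^+ 2.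
    by rewrite -[leRHS]real_normK ?num_real // ler_pXn2r // ?nnegrE ?ltW.
  by have := sqr_ge0 (ux u i); lra.
have tau_le : t <= t + tau by rewrite lerDl ltW.
have [/andP[lo0 hi0] /andP[lo1 hi1]] := (th_itv i t0, th_itv i (le_trans t0 tau_le)).
have rate m := @th_rate i t (t + tau) m t0 tau_le.
have addK : t + tau - t = tau by ring.
have [pos|neg] := constant_sign (divr_gt0 pi0 (ltr0Sn _ 3)) tau_le ttc tt_big.
  have [_] := rate (- c); rewrite addK mulNr ctau => h.
  have : ~ (forall u, t <= u <= t + tau -> gw u i <= - c) by move=> /h; lra.
  apply.
  move=> u htu; have u0 := u_ge0 u htu; rewrite (gwE i u0 (always_linked u0)).
  apply: sat_neg => //; [by rewrite lerNr | exact: ltW |].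
  by rewrite mulNr lerN2 (le_trans ck) // ler_pM2l //; exact: pos.
have [+ _] := rate c; rewrite addK ctau => h.
have : ~ (forall u, t <= u <= t + tau -> c <= gw u i) by move=> /h; lra.
apply.
move=> u htu; have u0 := u_ge0 u htu; rewrite (gwE i u0 (always_linked u0)).
apply: sat_pos => //; [exact: ltW |].
by rewrite mulNr -mulrN (le_trans ck) // ler_pM2l // lerNr; exact: neg.
Qed.

Lemma force_y_vanishing i : vanishing (fun t => uy t i).
Proof.
move=> e /(force_near_cut i)[T T0 hT]; exists T => // t /hT[] //.
Qed.

(** The forces along the first axis are eventually at most small and their sum
    is zero, so that they are small in absolute value. *)
Lemma force_x_vanishing i : vanishing (fun t => ux t i).
Proof.
(* The positive parts vanish in the limit, and they have the same sum as the
   negative parts. *)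
pose p j t := Num.max 0 (ux t j).
have p0 j : vanishing (p j).
  move=> e e0; have [T T0 hT] := force_near_cut j e0.
  exists T => // t /hT[lt_e _].
  by rewrite ger0_norm /p ?le_max ?lexx // gt_max e0.
have : vanishing (fun t => p i t + \sum_(j < N) p j t).
  by apply: vanishingD => //; apply: vanishing_sum.
move=> v e /v[T T0 hT]; exists T => // t /hT.
apply: le_lt_trans; rewrite [leRHS]ger0_norm; last first.
  by rewrite addr_ge0 ?sumr_ge0 // => [|j _]; rewrite /p le_max lexx.
have n_ge0 j : 0 <= p j t - ux t j by rewrite subr_ge0 le_max lexx orbT.
have pi_ge0 : 0 <= p i t by rewrite le_max lexx.
have : p i t - ux t i <= \sum_(j < N) p j t.
  have -> : \sum_(j < N) p j t = \sum_(j < N) (p j t - ux t j).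
    by rewrite sumrB [X in _ - X](sum_force G Esym) subr0.
  by rewrite (bigD1 i) //= lerDl sumr_ge0.
by have := n_ge0 i; rewrite ler_norml => *; apply/andP; split; lra.
Qed.

Lemma connected_ind (P : 'I_N -> 'I_N -> Prop) : (forall i, P i i) ->
  (forall i j l, P i j -> E j l -> P i l) -> forall i j, P i j.
Proof.
move=> P0 PS i j; have /connectP[p pth ->] := Econn i j.
elim/last_ind: p pth => [_|p l IH]; first exact: P0.
rewrite rcons_path last_rcons => /andP[/IH Pil]; exact: PS.
Qed.

(** [z] is one of the two coordinates. The sum of the forces weighted by the
    displacements from a fixed agent is, up to sign, a sum over edges of
    squared differences with weights bounded away from zero. *)
Lemma consensus (z : R -> 'I_N -> R) :
  (forall i j t, E i j -> 0 <= t -> `|z t j - z t i| <= 1 + rho2) ->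
  (forall i, vanishing (fun t => force E G (x t) (y t) (z t) i)) ->
  forall i j, vanishing (fun t => z t j - z t i).
Proof.
move=> zb zf.
have bounded i j : exists C, forall t, 0 <= t -> `|z t j - z t i| <= C.
  move: i j; apply: connected_ind => [i|i j l [C hC] Ejl].
    by exists 0 => t _; rewrite subrr normr0.
  exists (C + (1 + rho2)) => t t0.
  rewrite (_ : _ - _ = (z t j - z t i) + (z t l - z t j)); last by ring.
  by rewrite (le_trans (ler_normD _ _)) // lerD ?hC ?zb.
apply: connected_ind => [i|i j l vij Ejl].
  by move=> e e0; exists 0 => // t _; rewrite subrr normr0.
suff vjl : vanishing (fun t => z t l - z t j).
  move=> e /(vanishingD vij vjl)[T T0 hT]; exists T => // t /hT.
  by rewrite (_ : _ + _ = z t l - z t i) //; ring.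
have rho2_ge0 : 0 <= rho2 by apply: le_trans (edges_bounded (lexx 0) Ejl); exact: sqdist_ge0.
have Gc : {within `[0, rho2], continuous G}.
  apply: continuous_in_subspaceT => u; rewrite inE /= in_itv /= => /andP[_ ur].
  by apply: G_cont; exact: le_lt_trans rho2_lt.
have [c] := EVT_min rho2_ge0 Gc; rewrite in_itv /= => /andP[_ c_le] Gmin.
have Gc0 : 0 < G c by apply: G_gt0; exact: le_lt_trans rho2_lt.
pose g t := \sum_(a < N) force E G (x t) (y t) (z t) a * (z t a - z t j).
apply: (@vanishing_sqr_le _ _ g (G c)) => //; last first.
  apply: vanishing_sum => a _; have [C hC] := bounded j a.
  exact: vanishing_bounded hC (zf a).
move=> t t0.
have Gle a b : E a b -> G c <= G (sqdist (x t) (y t) a b).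
  by move=> Eab; apply: Gmin; rewrite in_itv /= sqdist_ge0 edges_bounded.
pose F a b := G (sqdist (x t) (y t) a b) * (z t b - z t a) ^+ 2.
have F0 a b : E a b -> 0 <= F a b.
  move=> Eab; rewrite mulr_ge0 ?sqr_ge0 //.
  exact: le_trans (ltW Gc0) (Gle _ _ Eab).
have -> : g t = - \sum_(a < N) \sum_(b < N | E a b) F a b.
  rewrite /g sum_force_power //; congr (- _); apply: eq_bigr => a _.
  by apply: eq_bigr => b _; rewrite /F; ring.
rewrite normrN ger0_norm; last by apply: sumr_ge0 => a _; apply: sumr_ge0 => b; exact: F0.
apply: (@le_trans _ _ (F j l)); first by rewrite ler_wpM2r ?sqr_ge0 ?Gle.
rewrite (bigD1 j) //= (bigD1 l) //= -addrA lerDl addr_ge0 //.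
  by apply: sumr_ge0 => b /andP[Ejb _]; exact: F0.
by apply: sumr_ge0 => a _; apply: sumr_ge0 => b; exact: F0.
Qed.

(** Connectivity is preserved and the positions reach consensus. *)
Lemma closed_loop_consensus :
  [/\ forall t i j, 0 <= t -> E i j -> sqdist (x t) (y t) i j <= rho2,
      forall i j, vanishing (fun t => x t j - x t i)
    & forall i j, vanishing (fun t => y t j - y t i)].
Proof.
split; first exact: edges_bounded.
  by apply: consensus force_x_vanishing => i j t; exact: edge_x_bounded.
by apply: consensus force_y_vanishing => i j t; exact: edge_y_bounded.
Qed.

End ClosedLoop.

(** * The maximum of the potential *)

Section Potential.
Context {R : realType} (N : nat) (E : rel 'I_N) (psi : R -> \bar R) (r : R).
Context (Psi_max : \bar R).
Hypothesis r_gt0 : 0 < r.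
Hypotheses (Esym : symmetric E) (Eirr : irreflexive E).
Hypothesis hpsi : generalized_potential E psi r Psi_max.

Lemma enormE (p : 'rV[R]_2) : enorm p = Num.sqrt (p 0 0 ^+ 2 + p 0 1 ^+ 2).
Proof. by []. Qed.

Lemma enorm_ge0 (p : 'rV[R]_2) : 0 <= enorm p.
Proof. exact: sqrtr_ge0. Qed.

Lemma psi_zero : psi 0 = 0%E.
Proof. by apply: (potential_eq0 hpsi _).1 => //; rewrite lexx ltW. Qed.

Section TwoValued.
Variables (c : R) (q : 'I_N -> 'rV[R]_2) (d : rel 'I_N).
Hypothesis psi_r : psi r = c%:E.
Hypothesis qd : forall a b, E a b -> enorm (q b - q a) = if d a b then r else 0.

(** A configuration whose edges have length 0 or [r], the latter at least
    once. *)
Lemma two_valued_potential a b : E a b -> d a b ->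
  (2^-1 * \sum_(a < N) \sum_(b < N | E a b) (if d a b then c else 0))%:E = Psi_max.
Proof.
move=> Eab dab; rewrite -(@potential_boundary _ _ _ _ _ _ hpsi q); last 2 first.
- by move=> a' b' /qd ->; case: ifP => // _; exact: ltW.
- by exists a, b; rewrite qd // dab.
rewrite /total_potential EFinM; congr (_ * _)%E.
rewrite -sumEFin; apply: eq_bigr => a' _; rewrite -sumEFin; apply: eq_bigr => b' Eab'.
by rewrite qd //; case: ifP => _; rewrite ?psi_r ?psi_zero.
Qed.

End TwoValued.

Let point (u v : R) : 'rV[R]_2 := \row_(l < 2) if l == 0 then u else v.

Let enorm_point (u v u' v' : R) :
  enorm (point u v - point u' v') = Num.sqrt ((u - u') ^+ 2 + (v - v') ^+ 2).
Proof. by rewrite enormE !mxE. Qed.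

Lemma sum_edge_pair (c : R) i j : E i j ->
  \sum_(a < N) \sum_(b < N | E a b) (if (a == i) && (b == j) then c else 0) = c.
Proof.
move=> Eij; rewrite (bigD1 i) //= [X in _ + X]big1 ?addr0; last first.
  by move=> a /negbTE ai; rewrite big1 // => b _; rewrite ai.
rewrite (bigD1 j) //= !eqxx big1 ?addr0 // => b /andP[_ /negbTE bj].
by rewrite bj andbF.
Qed.

(** The value of the potential on the boundary is the same for the three
    configurations in which [i], resp. [j], resp. [i] and [j] separately, are
    isolated from the other agents at mutual distance [r]. The first two values
    add up to the third one plus the contribution of the edge [i]--[j], which
    is therefore the whole maximum. *)
Lemma Psi_max_eq (c : R) i j : E i j -> psi r = c%:E -> Psi_max = c%:E.
Proof.
move=> Eij psi_r.
have ij : i != j by apply/eqP => ij; move: Eij; rewrite ij Eirr.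
have Eji : E j i by rewrite Esym.
have sqr0 : Num.sqrt (0 : R) = 0 by rewrite sqrtr0.
have sqrr : Num.sqrt (r ^+ 2) = r by rewrite sqrtr_sqr gtr0_norm.
have sqrt3 : Num.sqrt (3 : R) ^+ 2 = 3 by rewrite sqr_sqrtr.
pose q1 (k : 'I_N) (a : 'I_N) := point (if a == k then r else 0) 0.
pose d1 (k : 'I_N) (a b : 'I_N) := (a == k) (+) (b == k).
have q1d k a b : E a b -> enorm (q1 k b - q1 k a) = if d1 k a b then r else 0.
  move=> _; rewrite /q1 /d1 enorm_point subrr expr0n addr0.
  by case: (a == k); case: (b == k); rewrite /= ?subrr ?subr0 ?sub0r ?sqrrN ?expr0n.
(* the vertices of an equilateral triangle *)
pose pos a := if a == i then (r, 0) else if a == j then (0, 0)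
              else (r / 2, Num.sqrt 3 * r / 2).
pose q3 (a : 'I_N) := point (pos a).1 (pos a).2.
pose d3 (a b : 'I_N) := ((a == i) (+) (b == i)) || ((a == j) (+) (b == j)).
have q3d a b : E a b -> enorm (q3 b - q3 a) = if d3 a b then r else 0.
  move=> _; rewrite /q3 /d3 enorm_point /pos.
  case: (eqVneq a i) => [->|ai]; case: (eqVneq b i) => [->|bi];
    rewrite ?(negbTE ij) /=; case: (eqVneq a j) => aj; case: (eqVneq b j) => bj;
    rewrite /= ?subrr ?expr0n ?addr0 ?sqr0 ?sub0r ?subr0 ?sqrrN ?sqrr //;
    rewrite -[RHS]sqrr; congr Num.sqrt; rewrite ?exprMn ?sqrt3; by field.
have T1 := two_valued_potential psi_r (q1d i) Eij.
have T2 := two_valued_potential psi_r (q1d j) Eij.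
have T3 := two_valued_potential psi_r q3d Eij.
have ji : j == i = false by rewrite eq_sym (negbTE ij).
rewrite /d1 /d3 !eqxx ji (negbTE ij) in T1 T2 T3.
rewrite -T3 // in T1 T2 *.
move: (T1 isT) (T2 isT) => -[{}T1] [{}T2]; congr EFin.
have : \sum_(a < N) \sum_(b < N | E a b) (if (a == i) (+) (b == i) then c else 0) +
   \sum_(a < N) \sum_(b < N | E a b) (if (a == j) (+) (b == j) then c else 0) =
   \sum_(a < N) \sum_(b < N | E a b)
     (if ((a == i) (+) (b == i)) || ((a == j) (+) (b == j)) then c else 0)
   + (\sum_(a < N) \sum_(b < N | E a b) (if (a == i) && (b == j) then c else 0) +
      \sum_(a < N) \sum_(b < N | E a b) (if (a == j) && (b == i) then c else 0)).
  rewrite -!big_split; apply: eq_bigr => a _ /=; rewrite -!big_split; apply: eq_bigr => b Eab /=.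
  case: (eqVneq a i) => [->|ai]; case: (eqVneq b i) => [->|bi];
    rewrite ?(negbTE ij) /=; case: (eqVneq a j) => aj; case: (eqVneq b j) => bj;
    rewrite /= ?addr0 ?add0r //.
rewrite !sum_edge_pair //; move: T1 T2.
set S1 := \sum_(a < N) _; set S2 := \sum_(a < N) _; set S3 := \sum_(a < N) _.
by lra.
Qed.

End Potential.

(** * The potential as a function of the squared distance *)

Section Profile.
Context {R : realType} (psi : R -> \bar R) (r : R) (dpsi : R -> R).
Hypothesis r_gt0 : 0 < r.
Hypothesis psi0 : psi 0 = 0%E.
Hypothesis dpsiP : forall s : R, 0 <= s < r -> is_deriv_sq psi s (dpsi s).
Hypothesis dpsi_cont : {within `[0, r[, continuous dpsi}.

(** The potential as a function of the squared distance, extended linearly to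
    the negative numbers so that it is of class C^1 around 0; since
    [Num.sqrt] vanishes there, the derivative at every [u] is
    [dpsi (Num.sqrt u)]. *)
Definition profile (u : R) : R := fine (psi (Num.sqrt u)) + dpsi 0 * Num.min 0 u.

(** The derivative of [profile]. *)
Definition profile' (u : R) : R := dpsi (Num.sqrt u).

Lemma profile_ge0E u : 0 <= u -> profile u = fine (psi (Num.sqrt u)).
Proof. by move=> u0; rewrite /profile min_l // mulr0 addr0. Qed.

Lemma profile_lt0E u : u < 0 -> profile u = dpsi 0 * u.
Proof.
by move=> u0; rewrite /profile ler0_sqrtr ?ltW // psi0 add0r min_r // ltW.
Qed.

Lemma sqrt_lt_r u : u < r ^+ 2 -> 0 <= Num.sqrt u < r.
Proof.
move=> ur; rewrite sqrtr_ge0 /= -[ltRHS](ger0_norm (ltW r_gt0)) -sqrtr_sqr.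
by rewrite ltr_sqrt // exprn_gt0.
Qed.

Lemma profile_derive u : u < r ^+ 2 -> is_derive u 1 profile (profile' u).
Proof.
move=> ur.
suff lim : h^-1 *: (profile (h *: 1 + u) - profile u) @[h --> 0^'] --> profile' u.
  by split; [apply/cvg_ex; exists (profile' u) | exact: cvg_lim lim].
apply/cvgrPdist_le => e e0.
have [u0|u0] := ltP u 0.
  near=> h.
  have h0 : h != 0 by near: h; exact: nbhs_dnbhs_neq.
  have hu : `|h| < - u by near: h; apply: dnbhs0_lt; rewrite oppr_gt0.
  have hu0 : h + u < 0 by move: hu; rewrite ltr_norml => /andP[_]; lra.
  rewrite scaler1 !profile_lt0E // /profile' ler0_sqrtr ?ltW //.
  rewrite [_ *: _](_ : _ = dpsi 0) ?subrr ?normr0 ?ltW //.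
  by rewrite /GRing.scale /=; field.
have sr := sqrt_lt_r ur.
have := dpsiP sr; rewrite /is_deriv_sq sqr_sqrtr // => /cvgrPdist_le /(_ _ e0).
case=> d /= d0 quot.
have [e' e'0 ue'] : exists2 e', 0 < e' & 0 < u -> e' <= u.
  by have [u0'|u0'] := ltP 0 u; [exists u | exists 1].
near=> h.
have h0 : h != 0 by near: h; exact: nbhs_dnbhs_neq.
have hd : `|h| < d by near: h; exact: dnbhs0_lt.
rewrite scaler1 {2}/profile min_l // mulr0 addr0 /GRing.scale /=.
have [w0|w0] := leP 0 (h + u).
  rewrite profile_ge0E //.
  have := quot (h + u); rewrite /ball_ /= opprD addrCA subrr addr0 normrN.
  move=> /(_ hd); rewrite addrK mulrC; apply=> //.
  by rewrite -subr_eq0 addrK.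
have {}u0 : u = 0.
  apply/eqP; rewrite eq_le u0 andbT leNgt; apply/negP => upos.
  have : `|h| < e' by near: h; exact: dnbhs0_lt.
  by rewrite ltr_norml => /andP[? _]; have := ue' upos; lra.
move: w0; rewrite u0 addr0 => w0.
rewrite profile_lt0E // /profile' sqrtr0 psi0 subr0 mulrCA mulVf // mulr1.
by rewrite subrr normr0 ltW.
Unshelve. all: by end_near.
Qed.

Lemma profile'_cont u : u < r ^+ 2 -> {for u, continuous profile'}.
Proof.
move=> ur.
have /subspace_continuousP dc := dpsi_cont.
have := dc (Num.sqrt u); rewrite /= in_itv /= => /(_ (sqrt_lt_r ur)) dcu.
apply/cvgrPdist_le => e e0.
have /cvgrPdist_le /(_ _ e0) : dpsi x @[x --> within `[0, r[ (nbhs (Num.sqrt u))] -->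
    dpsi (Num.sqrt u) by exact: dcu.
rewrite near_withinE => dn.
have {}dn : \forall w \near u, Num.sqrt w \in `[0, r[ ->
    `|dpsi (Num.sqrt u) - dpsi (Num.sqrt w)| <= e.
  exact: (@sqrt_continuous R u _ dn).
near=> w.
have : w < r ^+ 2 by near: w; exact: lt_nbhsl.
move=> /sqrt_lt_r wr; rewrite /profile'.
by apply: (near dn w); rewrite ?in_itv.
Unshelve. all: by end_near.
Qed.

End Profile.

(** * From the potential to forces and energy *)

Section Gradient.
Context {R : realType} (psi : R -> \bar R) (r : R) (dpsi : R -> R).
Hypothesis r_gt0 : 0 < r.
Hypothesis psi0 : psi 0 = 0%E.
Hypothesis dpsiP : forall s : R, 0 <= s < r -> is_deriv_sq psi s (dpsi s).

Lemma enorm_lt (p : 'rV[R]_2) : (enorm p < r) = (p 0 0 ^+ 2 + p 0 1 ^+ 2 < r ^+ 2).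
Proof.
rewrite enormE -[X in _ < X](ger0_norm (ltW r_gt0)) -sqrtr_sqr.
by rewrite ltr_sqrt // exprn_gt0.
Qed.

Lemma grad_potential (q p : 'rV[R]_2) : enorm (q - p) < r ->
  grad (fun z => fine (psi (enorm (q - z)))) p =
  - (2 * profile' dpsi ((q 0 0 - p 0 0) ^+ 2 + (q 0 1 - p 0 1) ^+ 2)) *: (q - p).
Proof.
move=> qp; apply/rowP => l; rewrite !mxE.
(* F is the restriction of the function to the line through p parallel to the
   l-th axis. *)
pose a := q 0 0 - p 0 0; pose b := q 0 1 - p 0 1.
pose da : R := (0 == l)%:R; pose db : R := (1 == l)%:R.
pose F (h : R) := profile psi dpsi ((a - h * da) ^+ 2 + (b - h * db) ^+ 2).
have lt_r2 : a ^+ 2 + b ^+ 2 < r ^+ 2 by move: qp; rewrite enorm_lt !mxE.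
have dF : is_derive (0 : R) 1 F (profile' dpsi (a ^+ 2 + b ^+ 2) * (2 * a * - da + 2 * b * - db)).
  have lin (c d : R) : is_derive (0 : R) 1 (fun h : R => c - h * d) (- d).
    have -> : (fun h : R => c - h * d) = cst c - d *: id.
      by apply/funext => h; rewrite /GRing.scale /= fctE /= mulrC.
    have dl := is_deriveB (@is_derive_cst R R R c 0 1) (is_deriveZ d (@is_derive_id R R 0 1)).
    by apply: (is_derive_eq dl); rewrite sub0r /GRing.scale /= mulr1.
  have inner : is_derive (0 : R) 1 (fun h : R => (a - h * da) ^+ 2 + (b - h * db) ^+ 2)
      (2 * a * - da + 2 * b * - db).
    apply: (is_derive_eq (is_deriveD (is_derive_sqr (lin a da)) (is_derive_sqr (lin b db)))).
    by rewrite !mul0r !subr0.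
  apply: (@is_derive1_comp R (profile psi dpsi)) inner.
  by rewrite !mul0r !subr0; apply: (profile_derive r_gt0).
transitivity ('D_1 F 0).
  apply: (congr1 (fun g : R -> R => lim (g @ (0 : R)^'))); apply/funext => h /=.
  rewrite /F !profile_ge0E ?addr_ge0 ?sqr_ge0 // /GRing.scale /= mulr1 addr0.
  rewrite !mul0r !subr0 !enormE !mxE /= /a /b /da /db.
  congr (h^-1 * (_ - _)); congr (fine (psi (Num.sqrt (_ + _)))); congr (_ ^+ 2); ring.
rewrite derive_val /da /db /a /b.
have [->|->] : l = 0 \/ l = 1.
  by case: l {da db F dF} => -[|[|//]] ?; [left|right]; exact: val_inj.
  by rewrite /=; ring.
by rewrite /=; ring.
Qed.

End Gradient.

Section Network.
Context {R : realType} (N : nat) (E : rel 'I_N) (psi : R -> \bar R) (r : R).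
Context (Psi_max : \bar R) (dpsi : R -> R).
Hypothesis r_gt0 : 0 < r.
Hypothesis hpsi : generalized_potential E psi r Psi_max.
Hypothesis dpsiP : forall s : R, 0 <= s < r -> is_deriv_sq psi s (dpsi s).

Let xof (q : 'I_N -> 'rV[R]_2) i : R := q i 0 0.
Let yof (q : 'I_N -> 'rV[R]_2) i : R := q i 0 1.

Lemma enorm_edge (q : 'I_N -> 'rV[R]_2) i j :
  enorm (q j - q i) = Num.sqrt (sqdist (xof q) (yof q) i j).
Proof. by rewrite enormE !mxE. Qed.

Lemma total_potentialE (q : 'I_N -> 'rV[R]_2) :
  (forall i j, E i j -> enorm (q j - q i) < r) ->
  total_potential E psi q = (energy E (profile psi dpsi) (xof q) (yof q))%:E.
Proof.
move=> ql; rewrite /total_potential /energy EFinM; congr (_ * _)%E.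
rewrite -sumEFin; apply: eq_bigr => i _; rewrite -sumEFin; apply: eq_bigr => j Eij.
rewrite profile_ge0E ?sqdist_ge0 // -enorm_edge fineK //.
by apply: (potential_fin hpsi); rewrite enorm_ge0 ql.
Qed.

Lemma uhatE (q : 'I_N -> 'rV[R]_2) i :
  (forall j, E i j -> enorm (q j - q i) < r) ->
  uhat E psi q i 0 0 = force E (profile' dpsi) (xof q) (yof q) (xof q) i /\
  uhat E psi q i 0 1 = force E (profile' dpsi) (xof q) (yof q) (yof q) i.
Proof.
move=> ql.
have psi0 := psi_zero r_gt0 hpsi.
rewrite /uhat !mxE !summxE -!sumrN /force; split; apply: eq_bigr => j Eij;
  rewrite (grad_potential r_gt0 psi0 dpsiP (ql j Eij)) !mxE /sqdist /xof /yof; ring.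
Qed.

Lemma profile_ge0 u : 0 <= u -> u < r ^+ 2 -> 0 <= profile psi dpsi u.
Proof.
move=> u0 ur; rewrite profile_ge0E // fine_ge0 // (potential_ge0 hpsi) //.
by have /andP[-> /ltW] := sqrt_lt_r r_gt0 ur.
Qed.

(** The case of an infinite potential at the communication radius is
    included. *)
Lemma profile_barrier (L : R) : (L%:E < psi r)%E ->
  exists2 rho2, rho2 < r ^+ 2 &
    forall u, 0 <= u -> u < r ^+ 2 -> profile psi dpsi u <= L -> u <= rho2.
Proof.
move=> Lr.
have near_r : \forall s \near r^'-, (L%:E < psi s)%E.
  have := potential_cont hpsi; have := potential_ge0 hpsi (s := r).
  rewrite lexx ltW // => /(_ isT); move: Lr; case: (psi r) => [c|//|//].
    rewrite lte_fin => Lc _ /fine_cvg c_lim.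
    near=> s.
    have sfin : psi s \is a fin_num.
      apply: (potential_fin hpsi); apply/andP; split.
        by near: s; exact: nbhs_left_ge.
      by near: s; exact: nbhs_left_lt.
    rewrite -(fineK sfin) lte_fin.
    by near: s; exact: (cvgr_gt c c_lim).
  by move=> _ _ /cvgey_gtr /(_ L (num_real L)).
have [d /= d0 hd] := near_r.
pose rho := Num.max 0 (r - d).
have rho0 : 0 <= rho by rewrite le_max lexx.
have rho_lt : rho < r by rewrite gt_max r_gt0 gtrBl.
exists (rho ^+ 2); first by rewrite ltr_pXn2r // ?nnegrE // ltW.
move=> u u0 ur; rewrite profile_ge0E // => uL.
have sr := sqrt_lt_r r_gt0 ur; have /andP[s0 slt] := sr.
rewrite -[u]sqr_sqrtr // ler_pXn2r ?nnegrE // leNgt; apply/negP => rho_s.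
have := hd (Num.sqrt u); rewrite /ball_ /=.
have drs : `|r - Num.sqrt u| < d.
  rewrite ger0_norm ?subr_ge0 ?ltW //.
  by move: rho_s; rewrite gt_max => /andP[_]; lra.
move=> /(_ drs slt); rewrite -(fineK (potential_fin hpsi sr)) lte_fin.
by rewrite ltNge uL.
Unshelve. all: by end_near.
Qed.

End Network.

(** * The coordination theorem *)

Lemma has_rate_ext (R : realType) (f f' g g' : R -> R) :
  (forall t, 0 <= t -> f t = f' t) -> (forall t, 0 <= t -> g t = g' t) ->
  has_rate f g -> has_rate f' g'.
Proof.
move=> ff gg fg a b m a0 ab; have b0 : 0 <= b by exact: le_trans ab.
rewrite -!ff //; have [lo hi] := fg a b m a0 ab.
by split=> h; [apply: lo|apply: hi] => s hs; rewrite gg ?h //;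
  case/andP: hs => hs _; exact: le_trans hs.
Qed.

Lemma cvg_rV2 (R : realType) (f : R -> 'rV[R]_2) :
  vanishing (fun t => f t 0 0) -> vanishing (fun t => f t 0 1) ->
  f t @[t --> +oo] --> (0 : 'rV[R]_2).
Proof.
move=> /vanishing_cvg f0 /vanishing_cvg f1.
have -> : f = fun t => f t 0 0 *: delta_mx 0 0 + f t 0 1 *: delta_mx 0 1.
  apply/funext => t; apply/rowP => l; rewrite !mxE /=.
  have [->|->] : l = 0 \/ l = 1.
    by case: l => -[|[|//]] ?; [left|right]; exact: val_inj.
    by rewrite /= mulr1 mulr0 addr0.
  by rewrite /= mulr1 mulr0 add0r.
rewrite [X in _ --> X](_ : 0 = 0 *: delta_mx 0 0 + 0 *: delta_mx 0 1 :> 'rV[R]_2); last first.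
  by rewrite !scale0r addr0.
by apply: cvgD; apply: cvgZ => //; exact: cvg_cst.
Qed.

Theorem mainTheorem3 (R : realType) (N : nat) (E : rel 'I_N) (r k eps : R)
    (psi : R -> \bar R) (Psi_max : \bar R)
    (vlo vhi wlo whi : 'I_N -> R)
    (q : R -> 'I_N -> 'rV[R]_2) (theta : R -> 'I_N -> R)
    (hr : 0 < r) (hk : 0 < k) (heps : 0 < eps)
    (hv : forall i, vlo i < 0 < vhi i)
    (hw : forall i, wlo i < 0 < whi i)
    (hpsi : generalized_potential E psi r Psi_max)
    (hundirected : undirected_graph E)
    (hconnected : connected_graph E)
    (hloop : closed_loop E psi k vlo vhi wlo whi q theta)
    (hinit : forall i j, E i j -> enorm (q 0 j - q 0 i) <= r - eps)
    (hPsi : (total_potential E psi (q 0%R) < Psi_max)%E) :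
  (forall (t : R) (i j : 'I_N), 0 <= t -> E i j -> enorm (q t j - q t i) < r) /\
  (forall i j, q t i - q t j @[t --> +oo] --> (0 : 'rV[R]_2)).
Proof.
have [Eirr Esym] := hundirected.
(* Without edges, connectedness leaves at most one agent. *)
have [[i0 [j0 E0]]|noE] := pselect (exists i j, E i j); last first.
  split=> [t i j _ Eij|i j]; first by exfalso; apply: noE; exists i, j.
  have -> : i = j.
    have /connectP[[|l p]] := hconnected i j; first by move=> _ ->.
    by move=> /= /andP[Eil _]; exfalso; apply: noE; exists i, l.
  by under eq_fun do rewrite subrr; exact: cvg_cst.
have [dpsi [dpsi_spec dpsi_cont]] := potential_deriv hpsi.
have dpsiP s (sr : 0 <= s < r) := (dpsi_spec s sr).1.
have dpsi_gt0 s (sr : 0 <= s < r) := (dpsi_spec s sr).2.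
have psi0 := psi_zero hr hpsi.
have init i j : E i j -> enorm (q 0 j - q 0 i) < r.
  by move=> /hinit qr; apply: le_lt_trans qr _; rewrite gtrBl.
(* the trajectories, at rest before time 0 *)
pose x (t : R) i : R := q (Num.max 0 t) i 0 0; pose y (t : R) i : R := q (Num.max 0 t) i 0 1.
pose th (t : R) i := theta (Num.max 0 t) i.
have max0 (t : R) : 0 <= t -> Num.max 0 t = t by move=> t0; rewrite max_r.
have xE t : 0 <= t -> x t = fun i => q t i 0 0 by move=> t0; rewrite /x max0.
have yE t : 0 <= t -> y t = fun i => q t i 0 1 by move=> t0; rewrite /y max0.
have thE t : 0 <= t -> th t = theta t by move=> t0; rewrite /th max0.
pose gv t i := sat (vlo i) (vhi i) (vhat E psi (q t) (theta t) i).
pose gw t i := sat (wlo i) (whi i) (omegahat E psi k (q t) (theta t) i).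
pose M := \sum_(i < N) (`|vlo i| + `|vhi i| + `|wlo i| + `|whi i|).
have satM lo hi (z : R) : lo < 0 < hi -> `|sat lo hi z| <= `|lo| + `|hi|.
  move=> lh; have /andP[slo shi] := sat_itv z lh; have /andP[lo0 hi0] := lh.
  by rewrite (ltr0_norm lo0) (gtr0_norm hi0) ler_norml; apply/andP; split; lra.
have leM i : `|vlo i| + `|vhi i| + `|wlo i| + `|whi i| <= M.
  by rewrite /M (bigD1 i) //= lerDl sumr_ge0 // => j _; rewrite !addr_ge0.
have edge_lt t i j : 0 <= t -> sqdist (x t) (y t) i j < r ^+ 2 -> enorm (q t j - q t i) < r.
  by move=> t0; rewrite xE // yE // (enorm_lt hr) !mxE.
pose V0 := energy E (profile psi dpsi) (x 0) (y 0).
have V0E : total_potential E psi (q 0) = V0%:E.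
  by rewrite (total_potentialE dpsi hpsi init) /V0 xE ?yE.
have V0_lt : (V0%:E < psi r)%E.
  have := potential_ge0 hpsi (s := r); rewrite lexx ltW // => /(_ isT).
  have max_eq c : psi r = c%:E -> Psi_max = c%:E by exact: (Psi_max_eq hr Esym Eirr hpsi E0).
  move: hPsi max_eq; rewrite V0E; case: (psi r) => [c V0c max_eq _|_ _ _|//].
    by rewrite -(max_eq c erefl).
  exact: ltry.
have [rho2 rho2_lt barrier] := profile_barrier dpsi hr hpsi V0_lt.
have [edges cx cy] : [/\ forall t i j, 0 <= t -> E i j -> sqdist (x t) (y t) i j <= rho2,
    forall i j, vanishing (fun t => x t j - x t i)
  & forall i j, vanishing (fun t => y t j - y t i)].
  have edge_lt_of_linked t i j : 0 <= t -> linked E (r ^+ 2) x y t -> E i j ->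
      enorm (q t j - q t i) < r by move=> t0 tl Eij; apply: edge_lt => //; exact: tl.
  have forceE t i : 0 <= t -> linked E (r ^+ 2) x y t ->
      uhat E psi (q t) i 0 0 = force E (profile' dpsi) (x t) (y t) (x t) i /\
      uhat E psi (q t) i 0 1 = force E (profile' dpsi) (x t) (y t) (y t) i.
    move=> t0 tl; rewrite xE // yE //; apply: (uhatE hr hpsi dpsiP) => j Eij.
    exact: edge_lt_of_linked.
  have past i t : t <= 0 -> [/\ x t i = x 0 i, y t i = y 0 i & th t i = th 0 i].
    by move=> t0; rewrite /x /y /th max_l // max_l.
  apply: (@closed_loop_consensus R N E Esym Eirr (profile psi dpsi) (profile' dpsi) (r ^+ 2)
    _ _ _ _ vlo vhi wlo whi k hv x y th gv gw M _ _ _ _ _ _ _ _ _ _ rho2 rho2_lt barrier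
    hk hw hconnected).
  - exact: profile_ge0 hr hpsi.
  - exact: profile_derive hr psi0 dpsiP.
  - by move=> u ur; apply: dpsi_gt0; exact: sqrt_lt_r.
  - exact: profile'_cont hr dpsi_cont.
  - by move=> i t /(past i)[].
  - by move=> i t /(past i)[].
  - by move=> i t /(past i)[].
  - move=> i t _; apply: le_trans (leM i); apply: le_trans (satM _ _ _ (hv i)) _.
    by rewrite -addrA lerDl addr_ge0.
  - move=> i t _; apply: le_trans (leM i); apply: le_trans (satM _ _ _ (hw i)) _.
    by rewrite -[leRHS]addrA lerDr addr_ge0.
  - move=> i; apply: has_rate_ext (caratheodory_rate (dynamics_x hloop i)) => t t0.
      by rewrite xE.
    by rewrite thE.
  - move=> i; apply: has_rate_ext (caratheodory_rate (dynamics_y hloop i)) => t t0.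
      by rewrite yE.
    by rewrite thE.
  - move=> i; apply: has_rate_ext (caratheodory_rate (dynamics_theta hloop i)) => t t0 //.
    by rewrite thE.
  - move=> i t t0 tl; have [fx fy] := forceE t i t0 tl.
    rewrite /gv /vhat /thetatilde /thetahat enormE hypot_cosB fx fy thE //.
  - by move=> i j Eij; rewrite xE // yE //; have := init i j Eij; rewrite (enorm_lt hr) !mxE.
  - by move=> i t t0; rewrite thE //; exact: (orientation_range hloop).
  - move=> i t t0 tl; have [fx fy] := forceE t i t0 tl.
    by rewrite /gw /omegahat /thetatilde /thetahat fx fy thE.
split=> [t i j t0 Eij|i j].
  by apply: edge_lt => //; apply: le_lt_trans rho2_lt; exact: edges.
have late (f g : R -> R) : (forall t, 0 <= t -> f t = g t) -> vanishing f -> vanishing g.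
  move=> fg f0 e /f0[T T0 hT]; exists T => // t Tt.
  by rewrite -fg ?hT // (le_trans T0).
apply: cvg_rV2.
  by apply: late (cx j i) => t t0; rewrite !mxE xE.
by apply: late (cy j i) => t t0; rewrite !mxE yE.
Qed.
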